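(* If $\Sigma$ is a Lefschetz fan, then it also has the mixed HL and mixed HR properties.
   Context: $\Sigma$ is a $d$-dimensional rational simplicial fan in $\mathrm N=\mathbb R\otimes\mathrm N_{\mathbb Z}$; $A(\Sigma)$ is its Chow ring (piecewise polynomials modulo global linear functions). For a cone $\sigma$, $\mathrm{st}_\Sigma(\sigma)$ is the fan in $\mathrm N/\mathrm{span}(\sigma)$ of images of cones containing $\sigma$, with restriction map $\iota_\sigma^*:A(\Sigma)\to A(\mathrm{st}_\Sigma(\sigma))$. $\mathscr K(\Sigma)\subseteq A^1(\Sigma)$ consists of classes $\ell$ such that for every cone $\sigma$ (including $\{0\}$), $\iota_\sigma^*(\ell)$ has a piecewise linear representative positive on all nonzero points of the support of $\mathrm{st}_\Sigma(\sigma)$. $\Sigma$ is Lefschetz if: the $d$-dimensional Minkowski weights are spanned by a positive weight, inducing $\deg:A^d(\Sigma)\cong\mathbb R$; the pairing $A^k\times A^{d-k}\to\mathbb R$ is nondegenerate; for $k\le d/2$ and $\ell\in\mathscr K(\Sigma)$, multiplication by $\ell^{d-2k}:A^k\to A^{d-k}$ is an isomorphism; the form $(-1)^k\deg(\ell^{d-2k}\eta_1\eta_2)$ is positive definite on $\ker(\ell^{d-2k+1})\subseteq A^k$; and $\mathrm{st}_\Sigma(\sigma)$ is Lefschetz of dimension $d-k$ for every $k$-dimensional cone $\sigma$, $k>0$. Mixed HL: for $0\le k\le d/2$ and all $\ell_1,\dots,\ell_{d-2k}\in\mathscr K(\Sigma)$, multiplication by $\prod_{i=1}^{d-2k}\ell_i:A^k(\Sigma)\to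 A^{d-k}(\Sigma)$ is an isomorphism. Mixed HR: for $0\le k\le d/2$ and all $\ell_0,\dots,\ell_{d-2k}\in\mathscr K(\Sigma)$, the form $(\eta_1,\eta_2)\mapsto(-1)^k\deg((\prod_{i=1}^{d-2k}\ell_i)\eta_1\eta_2)$ is positive definite on the kernel of multiplication by $\prod_{i=0}^{d-2k}\ell_i$ on $A^k(\Sigma)$. *)

(* Defs.v *)
From HB Require Import structures.
From mathcomp Require Import all_boot all_order all_algebra.
From mathcomp Require Import finmap.
From mathcomp Require Import mathcomp_extra boolp classical_sets functions cardinality reals.

Set Implicit Arguments.
Unset Strict Implicit.
Unset Printing Implicit Defensive.

Import Order.TTheory GRing.Theory Num.Theory.

Local Open Scope classical_set_scope.
Local Open Scope ring_scope.
Local Open Scope quotient_scope.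

(* N / U is modelled by the complement U^C of U, with the projection along U.  *)
Section QuotientSpace.
Variables (R : fieldType) (N : vectType R) (U : {vspace N}).

Definition quotv : vectType R := subvs_of (U^C)%VS.

Definition quotv_proj (x : N) : quotv := vsproj (U^C)%VS (daddv_pi (U^C)%VS U x).

End QuotientSpace.

(* The data presenting a rational simplicial fan: a ray is named by an element *)
(* of a finite type and spanned by a lattice vector, not necessarily primitive *)
(* (images of primitive vectors in the ambient space of a star need not be);   *)
(* a cone is named by the set of its rays.  Indices that occur in no cone are  *)
(* ignored.  The conditions making this a fan are in [simplicial_fan].         *)
Record fan_data (R : realType) : Type := FanData {
  fspace : vectType R;
  lattice : set fspace;
  ray : finType;
  gen : ray -> fspace;
  cones : {set {set ray}} }.
Arguments lattice {R} f.
Arguments gen {R} f.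
Arguments cones {R} f.

Section Fan.
Variables (R : realType) (F : fan_data R).
Local Notation N := (fspace F).
Local Notation I := (ray F).
Implicit Types (s t : {set I}).

Definition cone_span s : {vspace N} := <<[seq gen F i | i <- enum s]>>%VS.

Definition cone_pts s : set N :=
  [set x | exists2 a : I -> R, (forall i, 0 <= a i)
                             & x = \sum_(i in s) a i *: gen F i].

Definition support : set N := [set x | exists2 s, s \in cones F & cone_pts s x].

Definition fan_dim : nat := \max_(s in cones F) #|s|.

Definition is_lattice (V : vectType R) (L : set V) : Prop :=
  exists b : (\dim {:V}).-tuple V, basis_of fullv b /\
    L = [set x | exists z : 'I_(\dim {:V}) -> int, x = \sum_i tnth b i *~ z i].

Record simplicial_fan : Prop := SimplicialFan {
  fan_lattice : is_lattice (lattice F);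
  fan_set0 : finset.set0 \in cones F;
  fan_face : forall s t, s \in cones F -> t \subset s -> t \in cones F;
  fan_gen : forall s i, s \in cones F -> i \in s -> lattice F (gen F i);
  fan_free : forall s, s \in cones F -> free [seq gen F i | i <- enum s];
  fan_cap : forall s t, s \in cones F -> t \in cones F ->
    cone_pts s `&` cone_pts t = cone_pts (s :&: t) }.

(* The star of s, a fan in N / span(s). *)
Definition star s : fan_data R :=
  @FanData R (quotv (cone_span s))
    (@quotv_proj _ _ (cone_span s) @` lattice F) I
    (fun i => quotv_proj (cone_span s) (gen F i))
    [set (t :\: s)%SET | t in [set t in cones F | s \subset t]]%SET.

(* The subfan of F, still in N, of the faces of the cones containing s. *)
Definition closed_star s : fan_data R :=
  @FanData R N (lattice F) I (gen F)
    [set t in cones F | (s :|: t)%SET \in cones F]%SET.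

End Fan.
Arguments support {R} F _.

Inductive polynomial_fun (R : realType) (V : vectType R) : (V -> R) -> Prop :=
| polynomial_const (c : R) : polynomial_fun (fun=> c)
| polynomial_lin (m : {scalar V}) : polynomial_fun m
| polynomial_add p q :
    polynomial_fun p -> polynomial_fun q -> polynomial_fun (p + q)
| polynomial_mul p q :
    polynomial_fun p -> polynomial_fun q -> polynomial_fun (p * q).

(* Piecewise polynomials are represented by functions on the whole of N, whose *)
(* values outside the support are irrelevant: functions that agree on the      *)
(* support are identified in the Chow ring, see [linear_ideal].                *)
Section PiecewisePolynomials.
Variables (R : realType) (F : fan_data R).
Local Notation N := (fspace F).

Definition piecewise_polynomial (f : N -> R) : Prop :=
  forall s, s \in cones F ->
    exists2 p, polynomial_fun p & forall x, cone_pts s x -> f x = p x.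

Definition pp_pred : {pred N -> R} := fun f => `[< piecewise_polynomial f >].

Lemma pp_subring_closed : subring_closed pp_pred.
Proof.
have opp (p : N -> R) : polynomial_fun p -> polynomial_fun (- p).
  move=> hp; rewrite -mulN1r.
  by apply: polynomial_mul => //; exact: (polynomial_const _ (-1)).
split.
- by apply/asboolP => s _; exists (fun=> 1) => //; exact: polynomial_const.
- move=> f g /asboolP hf /asboolP hg; apply/asboolP => s hs.
  have [p hp fp] := hf _ hs; have [q hq gq] := hg _ hs.
  exists (p - q); first by apply: polynomial_add => //; exact: opp.
  by move=> x hx; rewrite !fctE fp // gq.
- move=> f g /asboolP hf /asboolP hg; apply/asboolP => s hs.
  have [p hp fp] := hf _ hs; have [q hq gq] := hg _ hs.
  exists (p * q); first exact: polynomial_mul.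
  by move=> x hx; rewrite !fctE fp // gq.
Qed.

Record PP : Type := MkPP { pp_fun :> N -> R; _ : pp_fun \in pp_pred }.

HB.instance Definition _ := [isSub for pp_fun].
HB.instance Definition _ := [Choice of PP by <:].
HB.instance Definition _ :=
  GRing.SubChoice_isSubComPzRing.Build _ _ PP pp_subring_closed.

Definition pp_const (c : R) : PP.
Proof.
apply: (@MkPP (fun=> c)); apply/asboolP => s _.
by exists (fun=> c) => //; exact: polynomial_const.
Defined.

(* Functions agreeing on the support with an element of the ideal of piecewise *)
(* polynomials generated by the global linear functions.                       *)
Definition linear_ideal : set (N -> R) :=
  [set f | exists r : seq (PP * {scalar N}),
     forall x, support F x -> f x = \sum_(u <- r) u.1 x * u.2 x].

Definition linear_idealr : {pred PP} := fun f => `[< linear_ideal f >].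

Lemma linear_ideal_mul (f g : PP) :
  g \in linear_idealr -> f * g \in linear_idealr.
Proof.
move=> /asboolP [r gr]; apply/asboolP; exists [seq (f * u.1, u.2) | u <- r].
move=> x hx; rewrite big_map; transitivity (f x * g x) => //.
by rewrite gr // mulr_sumr; apply: eq_bigr => u _; rewrite mulrA.
Qed.

Lemma linear_ideal_zmod_closed : zmod_closed linear_idealr.
Proof.
split; first by apply/asboolP; exists [::] => x _; rewrite big_nil.
move=> f g /asboolP [r fr] gI.
have /asboolP[r' gr'] := linear_ideal_mul (- 1) gI.
apply/asboolP; exists (r ++ r') => x hx; rewrite big_cat /= -fr // -gr' //.
by rewrite mulN1r.
Qed.

HB.instance Definition _ :=
  GRing.isZmodClosed.Build _ linear_idealr linear_ideal_zmod_closed.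

Definition chow : Type := {ideal_quot linear_idealr}.

HB.instance Definition _ := GRing.Zmodule.on chow.

Definition chow_class (f : PP) : chow := \pi_({ideal_quot linear_idealr}) f.

Definition chow_mul (a b : chow) : chow := chow_class (repr a * repr b).

Lemma chow_classE f g : (chow_class f = chow_class g) <-> f - g \in linear_idealr.
Proof. by rewrite Quotient.idealrBE; split => [/eqP|/eqP]. Qed.

Lemma chow_reprK a : chow_class (repr a) = a.
Proof. exact: reprK. Qed.

Lemma chow_classD : {morph chow_class : f g / f + g}.
Proof. by move=> f g; rewrite /chow_class !piE. Qed.

Lemma chow_classM f g : chow_mul (chow_class f) (chow_class g) = chow_class (f * g).
Proof.
apply/chow_classE; set f' := repr _; set g' := repr _.
have hf : f' - f \in linear_idealr by apply/chow_classE/chow_reprK.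
have hg : g' - g \in linear_idealr by apply/chow_classE/chow_reprK.
have -> : f' * g' - f * g = f' * (g' - g) + g * (f' - f).
  by rewrite !mulrBr (mulrC g f') (mulrC g f) addrA subrK.
by rewrite rpredD ?linear_ideal_mul.
Qed.

Fact chow_mulA : associative chow_mul.
Proof.
move=> a b c; rewrite -(chow_reprK a) -(chow_reprK b) -(chow_reprK c).
by rewrite !chow_classM mulrA.
Qed.

Fact chow_mulC : commutative chow_mul.
Proof. by move=> a b; rewrite /chow_mul mulrC. Qed.

Fact chow_mul1 : left_id (chow_class 1) chow_mul.
Proof. by move=> a; rewrite -(chow_reprK a) chow_classM mul1r. Qed.

Fact chow_mulDl : left_distributive chow_mul +%R.
Proof.
move=> a b c; rewrite -(chow_reprK a) -(chow_reprK b) -(chow_reprK c).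
by rewrite !(chow_classM, =^~ chow_classD) mulrDl.
Qed.

HB.instance Definition _ := GRing.Zmodule_isComPzRing.Build chow
  chow_mulA chow_mulC chow_mul1 chow_mulDl.

Definition chow_scale (c : R) (a : chow) : chow := chow_class (pp_const c) * a.

Fact chow_scaleA c c' a : chow_scale c (chow_scale c' a) = chow_scale (c * c') a.
Proof.
rewrite /chow_scale mulrA; congr (_ * _); rewrite [LHS]chow_classM.
by congr chow_class; apply/val_inj.
Qed.

Fact chow_scale1 : left_id 1 chow_scale.
Proof.
move=> a; rewrite /chow_scale -[RHS]mul1r; congr (_ * _).
by congr chow_class; apply/val_inj.
Qed.

Fact chow_scaleDr : right_distributive chow_scale +%R.
Proof. by move=> c a b; rewrite /chow_scale mulrDr. Qed.

Fact chow_scaleDl a : {morph chow_scale^~ a : c c' / c + c'}.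
Proof.
move=> c c'; rewrite /chow_scale -mulrDl -chow_classD; congr (_ * _).
by congr chow_class; apply/val_inj.
Qed.

HB.instance Definition _ := GRing.Zmodule_isLmodule.Build R chow
  chow_scaleA chow_scale1 chow_scaleDr chow_scaleDl.

Definition pp_deg (k : nat) (f : PP) : Prop :=
  forall s, s \in cones F ->
    exists p, [/\ polynomial_fun p, forall x, cone_pts s x -> f x = p x
                & forall c x, p (c *: x) = c ^+ k * p x].

(* A^k *)
Definition chow_deg (k : nat) : set chow := chow_class @` pp_deg k.

(* The Courant function of the ray i, normalised by the chosen generators. *)
Definition courant (i : ray F) (f : PP) : Prop :=
  pp_deg 1 f /\
  forall j, [set j]%SET \in cones F -> f (gen F j) = (i == j)%:R.

End PiecewisePolynomials.
Arguments linear_ideal {R} F _.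

(* iota_s^* : the class of f goes to the class of g when the pullback of g to  *)
(* the closed star of s agrees with the restriction of f modulo the global     *)
(* linear functions on N; the pullback induces an isomorphism from A(star s)   *)
(* onto the Chow ring of the closed star.                                      *)
Definition chow_restr (R : realType) (F : fan_data R) (s : {set ray F})
    (a : chow F) : chow (star s) :=
  xget 0 [set b | exists (f : PP F) (g : PP (star s)),
    [/\ a = chow_class f, b = chow_class g &
        linear_ideal (closed_star s)
          (fun x => f x - g (quotv_proj (cone_span s) x))]].

(* The cone K(F) in A^1(F). *)
Definition ample (R : realType) (F : fan_data R) : set (chow F) :=
  [set l | chow_deg 1 l /\
    forall s, s \in cones F ->
      exists g : PP (star s),
        [/\ pp_deg 1 g, chow_restr s l = chow_class g
          & forall x, support (star s) x -> x != 0 -> 0 < g x]].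

Section MinkowskiWeights.
Variables (R : realType) (F : fan_data R).
Local Notation N := (fspace F).
Local Notation I := (ray F).

Definition primitive (V : vectType R) (L : set V) (u : V) : Prop :=
  [/\ L u, u != 0 & forall c : R, L (c *: u) -> exists z : int, c = z%:~R].

(* The primitive lattice vector on the ray spanned by v. *)
Definition primitive_on (V : vectType R) (L : set V) (v : V) : V :=
  xget 0 [set u | primitive L u /\ exists2 c : R, 0 < c & u = c *: v].

(* The index [L : M], for additive subgroups M of L. *)
Definition lattice_index (V : vectType R) (L M : set V) : nat :=
  #|` fset_set [set [set x + y | y in M] | x in L]|.

Definition cone_lattice (s : {set I}) : set N :=
  [set x | lattice F x /\ x \in cone_span s].

Definition gen_lattice (s : {set I}) : set N :=
  [set x | exists z : I -> int, x = \sum_(i in s) gen F i *~ z i].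

Definition mult (s : {set I}) : nat :=
  lattice_index (cone_lattice s) (gen_lattice s).

(* Only the values on the k-dimensional cones matter.  The vector e_(s/t) for  *)
(* s = i |: t is the primitive vector on the image of the ray i in N/span(t).  *)
Definition minkowski_weight (k : nat) (w : {set I} -> R) : Prop :=
  forall t, t \in cones F -> #|t|.+1 = k ->
    \sum_(i | (i \notin t) && ((i |: t)%SET \in cones F))
      w (i |: t)%SET *: primitive_on (lattice (star t)) (gen (star t) i) = 0.

Definition fundamental_weight (d : nat) (w : {set I} -> R) : Prop :=
  [/\ minkowski_weight d w,
      forall s, s \in cones F -> #|s| = d -> 0 < w s
    & forall w', minkowski_weight d w' ->
        exists c : R, forall s, s \in cones F -> #|s| = d -> w' s = c * w s].

(* The functional induced by w: the product of the Courant functions of the    *)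
(* primitive generators of a d-dimensional cone s is w s / mult s.  Rescaling  *)
(* generators rescales Courant functions inversely to the index below.         *)
Definition degree_map (d : nat) (w : {set I} -> R) (deg : {scalar chow F}) : Prop :=
  forall s, s \in cones F -> #|s| = d ->
  forall x : I -> PP F, (forall i, i \in s -> courant i (x i)) ->
    (mult s)%:R * deg (chow_class (\prod_(i in s) x i)) = w s.

End MinkowskiWeights.

Section LefschetzFans.
Variable R : realType.
Implicit Types (F : fan_data R) (d k : nat).

Definition poincare_duality F d (deg : chow F -> R) : Prop :=
  forall k, (k <= d)%N ->
    (forall a, chow_deg k a ->
       (forall b, chow_deg (d - k) b -> deg (a * b) = 0) -> a = 0) /\
    (forall b, chow_deg (d - k) b ->
       (forall a, chow_deg k a -> deg (a * b) = 0) -> b = 0).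

Definition mul_iso F (j k : nat) (L : chow F) : Prop :=
  set_bij (chow_deg j) (chow_deg k) ( *%R L).

Definition hr_positive F (deg : chow F -> R) (k : nat) (L0 L : chow F) : Prop :=
  forall a, chow_deg k a -> L0 * a = 0 -> a != 0 ->
    0 < (-1) ^+ k * deg (L * a * a).

Definition hard_lefschetz F d : Prop :=
  forall k l, (k.*2 <= d)%N -> ample l ->
    mul_iso k (d - k) (l ^+ (d - k.*2) : chow F).

Definition hodge_riemann F d (deg : chow F -> R) : Prop :=
  forall k l, (k.*2 <= d)%N -> ample l ->
    hr_positive deg k (l ^+ (d - k.*2).+1) (l ^+ (d - k.*2)).

(* w and deg are unique up to a common positive factor, on which no condition *)
(* depends; that deg is an isomorphism on A^d follows from duality for k = 0.  *)
Inductive lefschetz F d : Prop := Lefschetz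
  (w : {set ray F} -> R) (deg : {scalar chow F}) of
  simplicial_fan F & fan_dim F = d &
  fundamental_weight d w & degree_map d w deg &
  poincare_duality d deg &
  hard_lefschetz F d &
  hodge_riemann d deg &
  (forall s, s \in cones F -> (0 < #|s|)%N -> lefschetz (star s) (d - #|s|)).

Definition mixed_HL F d : Prop :=
  forall k, (k.*2 <= d)%N ->
  forall l : 'I_(d - k.*2) -> chow F, (forall i, ample (l i)) ->
    mul_iso k (d - k) (\prod_i l i).

Definition mixed_HR F d : Prop :=
  forall (w : {set ray F} -> R) (deg : {scalar chow F}),
  fundamental_weight d w -> degree_map d w deg ->
  forall k, (k.*2 <= d)%N ->
  forall (l0 : chow F) (l : 'I_(d - k.*2) -> chow F),
    ample l0 -> (forall i, ample (l i)) ->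
    hr_positive deg k (l0 * \prod_i l i) (\prod_i l i).

End LefschetzFans.

(* Main.v *)
From HB Require Import structures.
From mathcomp Require Import all_boot all_order all_algebra.
From mathcomp Require Import zify ring lra.
From mathcomp Require Import boolp classical_sets functions reals.
Require Import Defs.

(* Induction on the dimension.  Writing an ample class as a positive           *)
(* combination of Courant functions x_i, an element eta of A^k killed by       *)
(* l_1 ... l_(d-2k) satisfies                                                  *)
(*   0 = deg (l_1 ... l_(d-2k) eta^2)                                          *)
(*     = \sum_i c_i deg_i (l_2 ... l_(d-2k) eta^2 restricted to star i),       *)
(* with c_i > 0, where eta restricted to star i is primitive; the mixed        *)
(* Hodge-Riemann relations of the stars force all restrictions to vanish, so   *)
(* x_i eta = 0 for all i and eta = 0 by Poincare duality.  This gives mixed    *)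
(* hard Lefschetz.  For mixed Hodge-Riemann, move each l_i linearly to l_0:    *)
(* by mixed hard Lefschetz the Hodge-Riemann form stays nondegenerate, both on *)
(* A^k and on l_0 A^(k-1), hence on the primitive part, whose signature is     *)
(* therefore that of the unmixed case.                                         *)

Set Implicit Arguments.
Unset Strict Implicit.
Unset Printing Implicit Defensive.

Import Order.TTheory GRing.Theory Num.Theory.

Local Open Scope classical_set_scope.
Local Open Scope ring_scope.

(** * Paths of definite forms *)

(** The induction rests on a dictionary between a fan and the stars of its rays. An ample class is a
    combination of Courant functions with positive coefficients ([ample_rays]), ample classes
    restrict to ample classes ([ample_restr]), the degree of x_i a is a positive multiple of the
    degree of the restriction of a to the star of i ([degree_ray]), and x_i a = 0 as soon as that
    restriction vanishes ([chow_ray_restr0]). With these, the Hodge-Riemann relations of the stars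
    make each term of an expanded degree nonnegative, and a vanishing sum forces every restriction
    to vanish: this is the injectivity [mixed_HL_inj]. Poincare duality upgrades injectivity to an
    isomorphism ([mul_iso_inj]).

    Mixed Hodge-Riemann is a continuity argument ([mixed_HR_deg]): a path of nondegenerate symmetric
    forms that is positive definite at one end is so at the other ([posdef_path]). The primitive
    subspace moves along the path, so the form is replaced by one on all of A^k that is definite
    exactly when the original is definite on the moving subspace ([posdef_compl_path]).
    Nondegeneracy along the path is mixed hard Lefschetz in degrees k and k - 1.

    The algebra underneath comes from the fact that Courant functions generate the piecewise
    polynomials ([pp_mono_sum]). It makes every A^k finitely spanned and identifies [chow_restr],
    which is defined by a choice, with a graded ring homomorphism ([chow_restrE]). *)

Lemma horner_lipschitz (R : realFieldType) (p : {poly R}) (x : R) :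
  exists2 K, 0 < K & forall y, `|y - x| <= 1 -> `|p.[y] - p.[x]| <= K * `|y - x|.
Proof.
have /factor_theorem[q pq] : root (p - p.[x]%:P) x.
  by rewrite /root !hornerE subrr.
have [ub qub] := poly_itv_bound q (x - 1) (x + 1).
exists (`|ub| + 1) => [|y yx]; first by rewrite ltr_wpDl.
have -> : p.[y] - p.[x] = q.[y] * (y - x).
  by have := congr1 (horner^~ y) pq; rewrite !hornerE.
rewrite normrM ler_wpM2r //; have := qub y.
have := ler_norm ub; move: yx; rewrite ler_norml => /andP[? ?] ? qy.
suff /qy : x - 1 <= y <= x + 1 by lra.
by apply/andP; split; lra.
Qed.

Section PositiveDefinite.
Variables (R : realFieldType) (m : nat).
Implicit Types (S : 'M[R]_m) (u v w : 'rV[R]_m).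

Definition mxform S v w : R := (v *m S *m w^T) 0 0.

Definition posdef S := forall v, v != 0 -> 0 < mxform S v v.

Lemma mxformC S v w : S^T = S -> mxform S v w = mxform S w v.
Proof.
move=> St; rewrite /mxform.
suff -> : v *m S *m w^T = (w *m S *m v^T)^T by rewrite mxE.
by rewrite !trmx_mul trmxK St mulmxA.
Qed.

Lemma mxformDl S u v w : mxform S (u + v) w = mxform S u w + mxform S v w.
Proof. by rewrite /mxform !mulmxDl mxE. Qed.

Lemma mxformZl S c v w : mxform S (c *: v) w = c * mxform S v w.
Proof. by rewrite /mxform -!scalemxAl mxE. Qed.

Lemma mxform_sq S c v w : S^T = S ->
  mxform S (v + c *: w) (v + c *: w) =
    mxform S v v + 2 * c * mxform S v w + c ^+ 2 * mxform S w w.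
Proof.
move=> St; rewrite mxformDl mxformZl !(mxformC _ (v + _)) //.
rewrite !mxformDl !mxformZl (mxformC w v) //; ring.
Qed.

Lemma mxform_sum S v w : mxform S v w = \sum_i \sum_j v 0 i * w 0 j * S i j.
Proof.
rewrite /mxform mxE exchange_big /=; apply: eq_bigr => j _.
by rewrite !mxE mulr_suml; apply: eq_bigr => i _; ring.
Qed.

(** A null vector of a semidefinite form is orthogonal to everything, so nondegeneracy excludes it.
    This is how a limit of definite forms is seen to be definite. *)
Lemma posdef_semi S : S^T = S -> S \in unitmx ->
  (forall v, 0 <= mxform S v v) -> posdef S.
Proof.
move=> St Su S0 v; apply: contraNT; rewrite -leNgt => vle.
have v0 : mxform S v v = 0 by apply/le_anti; rewrite vle S0.
have vS w : mxform S v w = 0.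
  have Sw := S0 w; set a := mxform S v w; set b := mxform S w w in Sw *.
  have h c : 0 <= 2 * c * a + c ^+ 2 * b.
    by have := S0 (v + c *: w); rewrite mxform_sq // v0 add0r.
  have [b0|/negPf b0] := eqVneq b 0.
    by have := h 1; have := h (-1); rewrite b0; lra.
  have bp : 0 < b by rewrite lt_def b0.
  (* The quadratic in c is smallest at -a / b, with value -a^2 / b there; nonnegativity leaves a =
     0. *)
  have := h (- a / b).
  have -> : 2 * (- a / b) * a + (- a / b) ^+ 2 * b = - (a ^+ 2) / b.
    by field; rewrite b0.
  rewrite pmulr_lge0 ?invr_gt0 // oppr_ge0 => a2.
  have /eqP : a ^+ 2 = 0 by apply/le_anti; rewrite a2 sqr_ge0.
  by rewrite sqrf_eq0 => /eqP.
have : v *m S = 0.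
  apply/rowP => j; rewrite !mxE; have := vS (delta_mx 0 j).
  by rewrite /mxform trmx_delta -colE !mxE.
by move/(congr1 (mulmx^~ (invmx S))); rewrite mulmxK // mul0mx => ->.
Qed.

Lemma posdef_unit S : posdef S -> S \in unitmx.
Proof.
move=> Sp; rewrite -row_free_unit; apply/inj_row_free => v vS.
apply/eqP; apply: contraTT isT => /Sp; rewrite /mxform vS mul0mx mxE ltxx //.
Qed.

Lemma posdef_cauchy S v w : S^T = S -> posdef S ->
  mxform S v w ^+ 2 <= mxform S w w * mxform S v v.
Proof.
move=> St Sp; have [->|w0] := eqVneq w 0.
  by rewrite /mxform trmx0 !mulmx0 mxE mul0r expr0n.
have a0 := Sp _ w0; set a := mxform S w w in a0 *; set b := mxform S v w.
have [e|ne] := eqVneq (v + (- b / a) *: w) 0.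
  have : v = (b / a) *: w by apply/eqP; rewrite -subr_eq0 -scaleNr -mulNr e.
  rewrite /b => ->; set c := b / a.
  by rewrite !mxformZl (mxformC w) // mxformZl -/a le_eqVlt; apply/orP; left;
    apply/eqP; ring.
have := Sp _ ne; rewrite mxform_sq // -/a -/b => /ltW h.
rewrite -subr_ge0.
have -> : a * mxform S v v - b ^+ 2 =
  a * (mxform S v v + 2 * (- b / a) * b + (- b / a) ^+ 2 * a).
  by field; rewrite gt_eqF.
by rewrite mulr_ge0 // ltW.
Qed.

(** The i-th coordinate is the pairing with the vector [u i] dual to it under S, so Cauchy-Schwarz
    bounds it. The bound replaces compactness of the unit sphere. *)
Lemma posdef_coord_bound S : S^T = S -> posdef S ->
  exists2 K, 0 < K & forall v i, v 0 i ^+ 2 <= K * mxform S v v.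
Proof.
move=> St Sp; pose u i : 'rV_m := delta_mx 0 i *m invmx S.
have q0 v : 0 <= mxform S v v.
  by have [->|/Sp/ltW//] := eqVneq v 0; rewrite /mxform !mul0mx mxE.
exists (1 + \sum_i mxform S (u i) (u i)) => [|v i].
  by rewrite ltr_wpDr // sumr_ge0.
have -> : v 0 i = mxform S v (u i).
  rewrite /mxform /u trmx_mul trmx_inv St mulmxA mulmxK ?posdef_unit //.
  by rewrite trmx_delta -colE mxE.
apply: le_trans (posdef_cauchy _ _ St Sp) _.
rewrite ler_wpM2r // (bigD1 i) //= addrCA lerDl addr_ge0 //.
by rewrite sumr_ge0.
Qed.

End PositiveDefinite.

Section PolynomialPath.
Variables (R : realType) (m : nat) (S : 'M[{poly R}]_m).
Local Notation at_ t := (map_mx (horner_eval t) S).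

Lemma mxform_horner v w :
  exists p : {poly R}, forall t, mxform (at_ t) v w = p.[t].
Proof.
exists (\sum_i \sum_j (v 0 i * w 0 j) *: S i j) => t.
rewrite mxform_sum horner_sum; apply: eq_bigr => i _.
by rewrite horner_sum; apply: eq_bigr => j _; rewrite hornerZ mxE.
Qed.

Lemma posdef_open t : (at_ t)^T = at_ t -> posdef (at_ t) ->
  exists2 e, 0 < e & forall s, `|s - t| <= e -> posdef (at_ s).
Proof.
move=> St Sp; have [K K0 Kb] := posdef_coord_bound St Sp.
pose L i j := sval (cid2 (horner_lipschitz (S i j) t)).
have L0 i j : 0 < L i j by rewrite /L; case: cid2.
have LP i j s : `|s - t| <= 1 -> `|(S i j).[s] - (S i j).[t]| <= L i j * `|s - t|.
  by rewrite /L; case: cid2 => /= x _; apply.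
pose M := 1 + \sum_i \sum_j L i j.
have M0 : 0 < M by rewrite ltr_wpDr // sumr_ge0 // => i _; rewrite sumr_ge0 // => j _;
  exact/ltW.
have q0 v : 0 <= mxform (at_ t) v v.
  by have [->|/Sp/ltW//] := eqVneq v 0; rewrite /mxform !mul0mx mxE.
(* Radius 1 is the range of the Lipschitz bounds on the entries; (2 K M)^-1 keeps the change of the
   form at v below half its value at t, uniformly in v. *)
exists (Num.min 1 (2 * K * M)^-1); first by rewrite lt_min ltr01 invr_gt0 !mulr_gt0.
move=> s; rewrite le_min => /andP[s1 se] v v0.
have vb i j : `|v 0 i * v 0 j| <= K * mxform (at_ t) v v.
  rewrite normrM; have := Kb v i; have := Kb v j.
  rewrite -(real_normK (num_real (v 0 i))) -(real_normK (num_real (v 0 j))).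
  have := sqr_ge0 (`|v 0 i| - `|v 0 j|); rewrite sqrrB; lra.
have : `|mxform (at_ s) v v - mxform (at_ t) v v| <= mxform (at_ t) v v / 2.
  rewrite !mxform_sum -sumrB.
  under eq_bigr do rewrite -sumrB.
  rewrite -mxform_sum; set Q := mxform _ v v.
  have : K * Q * (\sum_i \sum_j L i j) * `|s - t| <= Q / 2.
    have KQ : 0 <= K * Q by apply: mulr_ge0; [exact: ltW | exact: q0].
    apply: (@le_trans _ _ (K * Q * M * (2 * K * M)^-1)).
      have L00 : 0 <= \sum_i \sum_j L i j.
        by apply: sumr_ge0 => i _; apply: sumr_ge0 => j _; exact/ltW.
      by apply: ler_pM => //; [exact: mulr_ge0 | rewrite ler_wpM2l // lerDr].
    rewrite [leLHS](_ : _ = Q / 2) //; field; by rewrite !gt_eqF.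
  apply: le_trans; rewrite mulr_sumr mulr_suml; apply: le_trans (ler_norm_sum _ _ _) _.
  apply: ler_sum => i _; rewrite mulr_sumr mulr_suml;
    apply: le_trans (ler_norm_sum _ _ _) _.
  apply: ler_sum => j _; rewrite -mulrBr normrM -[leRHS]mulrA.
  apply: ler_pM => //.
  by rewrite !mxE; apply: LP.
rewrite ler_norml => /andP[+ _]; have := Sp _ v0; lra.
Qed.

(** Definiteness propagates from 1 down to the infimum r of the t such that the form is definite on
    [t, 1]. At r it is a limit of definite forms, hence semidefinite, hence definite by
    nondegeneracy; openness would then go below r unless r = 0. *)
Lemma posdef_path :
  (forall t, 0 <= t <= 1 -> (at_ t)^T = at_ t /\ at_ t \in unitmx) ->
  posdef (at_ 1) -> posdef (at_ 0).
Proof.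
move=> Su S1.
pose T : set R := [set t | 0 <= t <= 1 /\ forall s, t <= s <= 1 ->
  posdef (at_ s)]%classic.
have T1 : T 1.
  by split=> [|s]; [rewrite ler01 lexx | rewrite -eq_le => /eqP<-].
have Tlb : lbound T 0 by move=> t [/andP[]].
have Tinf : has_inf T by split; [exists 1 | exists 0].
set r := inf T.
have r0 : 0 <= r by apply: lb_le_inf => //; exists 1.
have r1 : r <= 1 by apply: ge_inf => //; exists 0.
have above s : r < s -> s <= 1 -> posdef (at_ s).
  move=> rs s1; have [t [_ tp] ts] : exists2 t, T t & t < r + (s - r).
    by apply: inf_adherent => //; rewrite subr_gt0.
  by apply: tp; rewrite s1 andbT ltW // -[s](subrKC r).
have [rt ru] := Su r (introT andP (conj r0 r1)).
have atr : posdef (at_ r).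
  have [->//|rn1] := eqVneq r 1.
  have {rn1} r1' : r < 1 by rewrite lt_neqAle rn1.
  apply: posdef_semi => // v; rewrite leNgt; apply/negP => vneg.
  have v0 : v != 0 by apply: contraTneq vneg => ->; rewrite /mxform !mul0mx mxE ltxx.
  have [p pE] := mxform_horner v v.
  have [K K0 KP] := horner_lipschitz p r; rewrite pE in vneg.
  (* A negative value at r would persist, as a value at most 0, at r + h for this step h, against
     definiteness to the right of r. *)
  pose h := Num.min (Num.min 1 (1 - r)) (- p.[r] / K).
  have h0 : 0 < h by rewrite !lt_min ltr01 subr_gt0 r1' divr_gt0 // oppr_gt0.
  have [h1 hr hK] : [/\ h <= 1, h <= 1 - r & h <= - p.[r] / K].
    by split; rewrite /h !ge_min lexx ?orbT.
  have := KP (r + h); rewrite addrC addKr gtr0_norm // => /(_ h1).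
  have rh : 0 < p.[r + h] by rewrite -pE; apply: above => //; lra.
  move: hK; rewrite ler_pdivlMr // mulrC => hK.
  by rewrite ler_norml => /andP[_]; lra.
have [re|rn0] := eqVneq r 0; first by rewrite -re.
have rp : 0 < r by rewrite lt_def rn0.
have [e e0 eP] := posdef_open rt atr.
pose s := Num.max 0 (r - e).
have sr : s < r by rewrite gt_max rp /=; lra.
suff : T s by move=> /(ge_inf (ex_intro _ 0 Tlb)); rewrite leNgt sr.
split=> [|u /andP[su u1]]; first by rewrite le_max lexx /= (le_trans (ltW sr)).
have [ru'|ur] := ltP r u; first exact: above.
apply: eP; rewrite ler_norml; move: su; rewrite ge_max => /andP[_ ?].
by apply/andP; split; lra.
Qed.

End PolynomialPath.

(** * Definiteness on a moving orthogonal complement *)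

Section OrthogonalComplement.
Variables (m m' : nat).

(** The projection onto the Q-orthogonal complement of the rows of H, multiplied by the determinant
    of their Gram matrix. The adjugate in place of the inverse keeps the entries polynomial, so the
    construction makes sense over polynomials and commutes with evaluation. *)
Definition compl_proj (A : comNzRingType) (Q : 'M[A]_m) (H : 'M[A]_(m', m)) : 'M[A]_m :=
  \det (H *m Q *m H^T) *: 1%:M - Q *m H^T *m \adj (H *m Q *m H^T) *m H.

(** Q on the projections to the complement, plus a sum of squares of the pairings with the rows of
    H; see [mxform_compl]. The second summand is semidefinite and vanishes on the complement, so
    only the sign of Q on the complement is tested. *)
Definition compl_form (A : comNzRingType) (Q : 'M[A]_m) (H : 'M[A]_(m', m)) : 'M[A]_m :=
  compl_proj Q H *m Q *m (compl_proj Q H)^T + Q *m H^T *m (H *m Q).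

Lemma map_compl_proj (A B : comNzRingType) (f : {rmorphism A -> B}) Q H :
  map_mx f (compl_proj Q H) = compl_proj (map_mx f Q) (map_mx f H).
Proof.
rewrite /compl_proj map_mxD map_mxN map_mxZ map_mx1 !(map_mxM, map_mx_adj).
by rewrite -det_map_mx !(map_mxM, map_trmx).
Qed.

Lemma map_compl_form (A B : comNzRingType) (f : {rmorphism A -> B}) Q H :
  map_mx f (compl_form Q H) = compl_form (map_mx f Q) (map_mx f H).
Proof.
by rewrite /compl_form map_mxD !map_mxM -!map_trmx map_compl_proj.
Qed.

Variables (R : realFieldType) (Q : 'M[R]_m) (H : 'M[R]_(m', m)).
Hypothesis Qt : Q^T = Q.
Local Notation C := (H *m Q *m H^T).
Local Notation P := (compl_proj Q H).

Lemma compl_projE (v : 'rV_m) :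
  v *m P = \det C *: v - v *m Q *m H^T *m \adj C *m H.
Proof. by rewrite /compl_proj mulmxBr -scalemxAr mulmx1 !mulmxA. Qed.

Lemma compl_proj_orth (v : 'rV_m) : v *m P *m Q *m H^T = 0.
Proof.
rewrite compl_projE !mulmxBl -!scalemxAl -[_ *m \adj C *m H *m Q *m _]mulmxA.
rewrite -[_ *m \adj C *m H *m _]mulmxA -[_ *m \adj C *m _]mulmxA (mulmxA H) mul_adj_mx.
by rewrite mul_mx_scalar subrr.
Qed.

Lemma compl_proj_id (v : 'rV_m) : v *m Q *m H^T = 0 -> v *m P = \det C *: v.
Proof. by move=> vH; rewrite compl_projE vH !mul0mx subr0. Qed.

Lemma compl_form_sym : (compl_form Q H)^T = compl_form Q H.
Proof. by rewrite /compl_form linearD /= !trmx_mul !trmxK Qt !mulmxA. Qed.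

Lemma mxform_compl (v w : 'rV_m) :
  mxform (compl_form Q H) v w =
  mxform Q (v *m P) (w *m P) + \sum_j (v *m Q *m H^T) 0 j * (w *m Q *m H^T) 0 j.
Proof.
rewrite /mxform /compl_form mulmxDr mulmxDl [LHS]mxE; congr (_ + _).
  by rewrite trmx_mul !mulmxA.
rewrite !mulmxA -[_ *m H *m Q *m w^T]mulmxA -[_ *m H *m (_ *m _)]mulmxA.
have -> : H *m (Q *m w^T) = (w *m Q *m H^T)^T by rewrite !trmx_mul trmxK Qt.
by rewrite mxE; apply: eq_bigr => j _; rewrite [_^T j 0]mxE.
Qed.

Hypotheses (Qu : Q \in unitmx) (Cu : C \in unitmx).

Let D0 : \det C != 0. Proof. by rewrite -unitfE -unitmxE. Qed.

Lemma compl_form_unit : compl_form Q H \in unitmx.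
Proof.
rewrite -row_free_unit; apply/inj_row_free => v vS.
have vS0 w : mxform (compl_form Q H) v w = 0 by rewrite /mxform vS mul0mx mxE.
(* Testing against vectors of the complement: on them the sum of squares drops out and P acts as the
   nonzero scalar [\det C]. *)
have vPw w : mxform Q (v *m P) (w *m P) = 0.
  have := vS0 (w *m P); rewrite mxform_compl compl_proj_orth big1 => [|j _].
    rewrite addr0 (compl_proj_id (compl_proj_orth w)) (mxformC _ (_ *: _)) //.
    rewrite mxformZl mxformC // => /eqP; rewrite mulf_eq0 (negPf D0) => /eqP//.
  by rewrite [X in _ * X]mxE mulr0.
have vP : v *m P = 0.
  suff : v *m P *m Q = 0.
    by move/(congr1 (mulmx^~ (invmx Q))); rewrite mulmxK // mul0mx.
  apply/rowP => j; have := vPw (delta_mx 0 j).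
  rewrite (compl_projE (delta_mx 0 j)) /mxform [(_ - _)^T]linearB /= mulmxBr [(_ *:
    _)^T]linearZ /= -scalemxAr.
  rewrite [(_ *m H)^T]trmx_mul !mulmxA compl_proj_orth mul0mx subr0 mxE.
  rewrite trmx_delta -colE mxE => /eqP; rewrite mulf_eq0 (negPf D0) => /eqP ->.
  by rewrite mxE.
(* Once v P = 0, the form at v is a vanishing sum of squares, so v lies in the complement, where P
   is a nonzero scalar; hence v = 0. *)
have := vS0 v; rewrite mxform_compl vP /mxform !mul0mx mxE add0r => /eqP.
rewrite psumr_eq0 => [/allP vQH|j _]; last by rewrite -expr2 sqr_ge0.
have /compl_proj_id : v *m Q *m H^T = 0.
  apply/rowP => j; rewrite [RHS]mxE; apply/eqP.
  by rewrite -sqrf_eq0 expr2; apply: vQH; rewrite mem_index_enum.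
by rewrite vP => /esym/eqP; rewrite scaler_eq0 (negPf D0) => /eqP.
Qed.

Lemma compl_form_posdef :
  posdef (compl_form Q H) <->
  (forall v, v != 0 -> v *m Q *m H^T = 0 -> 0 < mxform Q v v).
Proof.
split=> [Sp v v0 vH|Qp v v0].
  have := Sp v v0; rewrite mxform_compl vH big1 => [|j _]; last by rewrite mxE mulr0.
  rewrite addr0 compl_proj_id // mxformZl mxformC // mxformZl mulrA -expr2.
  by rewrite pmulr_rgt0 // exprn_even_gt0.
have sq0 : 0 <= \sum_j (v *m Q *m H^T) 0 j * (v *m Q *m H^T) 0 j.
  by apply: sumr_ge0 => j _; rewrite -expr2 sqr_ge0.
rewrite mxform_compl; have [vP|vP] := eqVneq (v *m P) 0; last first.
  by rewrite ltr_pwDl // Qp // compl_proj_orth.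
rewrite vP {1}/mxform !mul0mx mxE add0r lt_def sq0 andbT.
apply: contra_neq v0 => /eqP.
rewrite psumr_eq0 => [/allP vQH|j _]; last by rewrite -expr2 sqr_ge0.
have /compl_proj_id : v *m Q *m H^T = 0.
  apply/rowP => j; rewrite [RHS]mxE; apply/eqP.
  by rewrite -sqrf_eq0 expr2; apply: vQH; rewrite mem_index_enum.
by rewrite vP => /esym/eqP; rewrite scaler_eq0 (negPf D0) => /eqP.
Qed.

End OrthogonalComplement.

(* The moving complement of the row space of H is traded for a form on the     *)
(* whole space that is definite exactly when Q is definite on the complement.  *)
Lemma posdef_compl_path (R : realType) (m m' : nat) (Q : 'M[{poly R}]_m)
    (H : 'M[R]_(m', m)) (Q_ := fun t => map_mx (horner_eval t) Q) :
  (forall t, 0 <= t <= 1 ->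
     [/\ (Q_ t)^T = Q_ t, Q_ t \in unitmx & H *m Q_ t *m H^T \in unitmx]) ->
  (forall v, v != 0 -> v *m Q_ 1 *m H^T = 0 -> 0 < mxform (Q_ 1) v v) ->
  (forall v, v != 0 -> v *m Q_ 0 *m H^T = 0 -> 0 < mxform (Q_ 0) v v).
Proof.
move=> Qu Q1; pose S := compl_form Q (map_mx polyC H).
have SE t : map_mx (horner_eval t) S = compl_form (Q_ t) H.
  rewrite map_compl_form; suff -> : map_mx (horner_eval t) (map_mx polyC H) = H by [].
  by apply/matrixP => i j; rewrite !mxE [LHS]hornerC.
have [|Qt Q0u C0u] := Qu 0; first by rewrite lexx ler01.
have [|Q1t Q1u C1u] := Qu 1; first by rewrite lexx ler01.
apply/compl_form_posdef => //; rewrite -SE; apply: posdef_path => [t t01|].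
  by have [? ? ?] := Qu t t01; rewrite SE compl_form_sym // compl_form_unit.
by rewrite SE; apply/compl_form_posdef.
Qed.

(** * Coordinates on a simplicial fan *)

Section Cones.
Variables (R : realType) (F : fan_data R).
Local Notation N := (fspace F).
Local Notation I := (ray F).
Implicit Types (s t : {set I}) (a b e : I -> R).

Definition gcomb a : N := \sum_i a i *: gen F i.

Definition supp_in s a := forall i, i \notin s -> a i = 0.

Lemma gcomb_in s a : supp_in s a -> gcomb a = \sum_(i in s) a i *: gen F i.
Proof.
move=> sa; rewrite /gcomb (bigID (mem s)) /= [X in _ + X]big1 ?addr0 // => i /sa->.
by rewrite scale0r.
Qed.

Lemma gcombD a b : gcomb (fun i => a i + b i) = gcomb a + gcomb b.
Proof. by rewrite -big_split; apply: eq_bigr => i _; rewrite scalerDl. Qed.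

Lemma gcombB a b : gcomb (fun i => a i - b i) = gcomb a - gcomb b.
Proof. by rewrite -sumrB; apply: eq_bigr => i _; rewrite scalerBl. Qed.

Lemma gcombZ c a : gcomb (fun i => c * a i) = c *: gcomb a.
Proof. by rewrite /gcomb scaler_sumr; apply: eq_bigr => i _; rewrite scalerA. Qed.

Lemma cone_ptsP s x : cone_pts s x <->
  exists a, [/\ forall i, 0 <= a i, supp_in s a & x = gcomb a].
Proof.
split=> [[a a0 ->]|[a [a0 sa ->]]]; last by exists a => //; rewrite (gcomb_in sa).
exists (fun i => if i \in s then a i else 0); split=> [i|i /negPf->//|].
  by case: ifP.
rewrite (@gcomb_in s) => [|i /negPf->//].
by apply: eq_bigr => i ->.
Qed.

Lemma cone_spanP s x : reflect (exists2 e, supp_in s e &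
  x = gcomb e) (x \in cone_span s).
Proof.
rewrite /cone_span span_def big_map big_enum.
apply: (iffP memv_sumP) => [[v vs ->]|[e es ->]].
  have /choice[e eP] i : exists c, i \in s -> v i = c *: gen F i.
    by case: (boolP (i \in s)) => [/vs/vlineP[c ->]|_]; [exists c | exists 0].
  exists (fun i => if i \in s then e i else 0) => [i /negPf->//|].
  rewrite (@gcomb_in s) => [|i /negPf->//]; apply: eq_bigr => i si.
  by rewrite si -eP.
exists (fun i => e i *: gen F i); last by rewrite (gcomb_in es).
by move=> i _; rewrite memvZ // memv_line.
Qed.

Lemma cone_pts_sub s t x : s \subset t -> cone_pts s x -> cone_pts t x.
Proof.
move=> /fintype.subsetP st /cone_ptsP[a [a0 sa ->]]; apply/cone_ptsP; exists a;
  split=> //.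
by move=> i it; apply: sa; apply: contra it => /st.
Qed.

(** The combinatorial content of a simplicial fan: nonnegative coordinates supported on a cone are
    determined by the point. In this form it passes to stars and closed stars by elementary
    arguments. *)
Record unique_coords : Prop := UniqueCoords {
  coords_set0 : finset.set0 \in cones F;
  coords_face : forall s t, s \in cones F -> t \subset s -> t \in cones F;
  coords_inj : forall s t a b, s \in cones F -> t \in cones F ->
    (forall i, 0 <= a i) -> (forall i, 0 <= b i) ->
    supp_in s a -> supp_in t b -> gcomb a = gcomb b -> a =1 b }.

Lemma gens_tuple s :
  [seq gen F i | i <- enum s] = [tuple gen F (enum_val k) | k < #|s|].
Proof.
have <- : [seq enum_val k | k <- enum 'I_#|s|] = enum s; last first.
  by rewrite /= -map_comp; apply: eq_map.
have [->|[i0 _]] := set_0Vmem s.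
  rewrite [RHS]size0nil ?[LHS]size0nil //; first by rewrite size_map size_enum_ord
    cards0.
  by rewrite -cardE cards0.
apply: (@eq_from_nth _ i0) => [|j]; rewrite size_map size_enum_ord -?cardE // => js.
by rewrite (nth_map (Ordinal js)) ?size_enum_ord // (nth_ord_enum _ (Ordinal js))
  (enum_val_nth i0).
Qed.

(** A point of two cones s and t has a third expression on the common face [s :&: t]; linear
    independence on s and on t equates both given expressions with it. *)
Lemma simplicial_unique_coords : simplicial_fan F -> unique_coords.
Proof.
move=> [_ c0 cf _ cfree ccap]; split=> // s t a b sF tF a0 b0 sa tb ab.
have indep u e : u \in cones F -> supp_in u e -> gcomb e = 0 -> forall i, e i = 0.
  move=> uF ue e0 i; case: (boolP (i \in u)) => [iu|/ue//].
  have := cfree u uF; rewrite gens_tuple => /freeP/(_ (fun k => e (enum_val k))).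
  have -> : \sum_(k < #|u|) e (enum_val k) *: [tuple gen F (enum_val k) | k < #|u|]`_k
    = 0.
    rewrite -[RHS]e0 (gcomb_in ue) [RHS]big_enum_val; apply: eq_bigr => k _.
    by rewrite -tnth_nth tnth_mktuple.
  by move=> /(_ erefl (enum_rank_in iu i)); rewrite enum_rankK_in.
have /cone_ptsP[c [c0' cs xc]] : cone_pts (s :&: t) (gcomb a).
  rewrite -ccap //; split; apply/cone_ptsP; first by exists a.
  by exists b.
have ac i : a i - c i = 0.
  apply: (indep s (fun i => a i - c i)) => // [j js|]; last by rewrite gcombB xc subrr.
  by rewrite sa // cs ?subrr // inE negb_and js.
have bc i : b i - c i = 0.
  apply: (indep t (fun i => b i - c i)) => // [j js|];
    last by rewrite gcombB -ab xc subrr.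
  by rewrite tb // cs ?subrr // inE negb_and js orbT.
by move=> i; rewrite (subr0_eq (ac i)) (subr0_eq (bc i)).
Qed.

Hypothesis UF : unique_coords.

(** The positive and negative parts of e are two nonnegative expressions of one point of the
    cone. *)
Lemma cone_indep s e : s \in cones F -> supp_in s e -> gcomb e = 0 -> forall i, e i = 0.
Proof.
move=> sF se e0 i.
pose a i := Num.max (e i) 0; pose b i := Num.max (- e i) 0.
have ab j : e j = a j - b j.
  by rewrite /a /b; case: ltrgtP => h; case: ltrgtP => h'; lra.
have : a =1 b.
  apply: (coords_inj UF (s := s) (t := s)) => //.
  - by move=> j; rewrite le_max lexx orbT.
  - by move=> j; rewrite le_max lexx orbT.
  - by move=> j /se; rewrite /a => ->; rewrite maxxx.
  - by move=> j /se; rewrite /b => ->; rewrite oppr0 maxxx.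
  apply/eqP; rewrite -subr_eq0 -gcombB -e0; apply/eqP.
  by apply: eq_bigr => j _; rewrite ab.
by rewrite ab => ->; rewrite subrr.
Qed.

(** The linear function that the j-th Courant function restricts to on s; for j outside s it is
    zero. *)
Lemma dual_form s j : s \in cones F ->
  exists m : {scalar N}, forall k, k \in s -> m (gen F k) = (k == j)%:R.
Proof.
move=> sF; pose T := [tuple gen F (enum_val k) | k < #|s|].
have Tfree : free T.
  apply/freeP => c; pose e i := if insub i : option {i | i \in s} is Some u then
    c (enum_rank_in (valP u) (val u)) else 0 => c0 k.
  have ek k' : e (enum_val k') = c k'.
    rewrite /e insubT ?enum_valP // => h; rewrite /= enum_valK_in //.
  rewrite -ek; apply: (cone_indep (s := s)) => //.
    by move=> i si; rewrite /e insubF //; apply/negbTE.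
  rewrite (@gcomb_in s); last by move=> i si; rewrite /e insubF //; apply/negbTE.
  rewrite big_enum_val -[RHS]c0; apply: eq_bigr => i _.
  by rewrite ek -tnth_nth tnth_mktuple.
case: (boolP (j \in s)) => js; last first.
  exists (\0 : {scalar N}) => k ks.
  by case: eqP ks js => [->->|].
exists (coord T (enum_rank_in js j)) => k ks.
have -> : gen F k = T`_(enum_rank_in js k).
  by rewrite -tnth_nth tnth_mktuple enum_rankK_in.
apply: (etrans (coord_free _ _ Tfree)); congr (_ %:R); congr nat_of_bool.
apply/eqP/eqP => [/(congr1 enum_val)|->//]; by rewrite !enum_rankK_in.
Qed.

Lemma gcomb_linear (m : {scalar N}) e : m (gcomb e) = \sum_i e i * m (gen F i).
Proof. by rewrite linear_sum; apply: eq_bigr => i _; rewrite linearZ. Qed.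

Lemma dual_form_gcomb s j (m : {scalar N}) e :
  (forall k, k \in s -> m (gen F k) = (k == j)%:R) -> supp_in s e -> m (gcomb e) = e j.
Proof.
move=> mE se; rewrite gcomb_linear (bigD1 j) //= big1 => [|i ij].
  case: (boolP (j \in s)) => [/mE->|/se->]; last by rewrite mul0r addr0.
  by rewrite eqxx mulr1 addr0.
by case: (boolP (i \in s)) => [/mE->|/se->]; rewrite ?mul0r // (negPf ij) mulr0.
Qed.

End Cones.
Arguments gcomb {R} F a.
Arguments unique_coords {R} F.

(** * Polynomial and piecewise polynomial functions on cones *)

Lemma polynomial_line (R : realType) (V : vectType R) (p : V -> R) :
  polynomial_fun p -> forall b x, exists q : {poly R}, forall c, p (b + c *: x) = q.[c].
Proof.
move=> hp b x; elim: {p} hp => [c|m|p q _ [p' pE] _ [q' qE]|p q _ [p' pE] _ [q' qE]].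
- by exists c%:P => c'; rewrite hornerC.
- by exists ((m b)%:P + m x *: 'X) => c; rewrite linearD linearZ !hornerE /= mulrC.
- by exists (p' + q') => c; rewrite hornerD -pE -qE.
- by exists (p' * q') => c; rewrite hornerM -pE -qE.
Qed.

(* A polynomial vanishing on a segment of positive length from an interior     *)
(* point of the cone vanishes on the whole line.                               *)
Lemma polynomial_cone_span (R : realType) (F : fan_data R) (s : {set ray F}) p q :
  polynomial_fun p -> polynomial_fun q ->
  (forall x, cone_pts s x -> p x = q x) ->
  forall x, x \in cone_span s -> p x = q x.
Proof.
move=> hp hq pq x /cone_spanP[e se ->]{x}.
(* The sum b of the generators is interior to the cone, and the line from b in direction e' passes
   through the given point at parameter 1. *)
pose b i : R := (i \in s)%:R; pose e' i := e i - b i.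
have sb : supp_in s b by move=> i /negPf; rewrite /b => ->.
have se' : supp_in s e' by move=> i is_; rewrite /e' se // sb // subrr.
have -> : gcomb F e = gcomb F b + 1 *: gcomb F e'.
  by rewrite scale1r gcombB addrC subrK.
have [p' pE] := polynomial_line hp (gcomb F b) (gcomb F e').
have [q' qE] := polynomial_line hq (gcomb F b) (gcomb F e').
rewrite pE qE; congr horner; apply/eqP; rewrite -subr_eq0; apply/eqP.
pose M := 1 + \sum_i `|e' i|.
have eM i : `|e' i| <= M.
  by rewrite /M (bigD1 i) //= addrCA lerDl addr_ge0 // sumr_ge0.
have M0 : 0 < M by rewrite ltr_wpDr // sumr_ge0.
(* Infinitely many parameters, each small enough that no coordinate 1 + z e'_i becomes negative. *)
pose z n : R := M^-1 / n.+1%:R.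
have zr n : root (p' - q') (z n).
  rewrite /root hornerD hornerN -pE -qE subr_eq0; apply/eqP/pq/cone_ptsP.
  exists (fun i => b i + z n * e' i); split=> [i||].
  - case: (boolP (i \in s)) => si; last by rewrite sb // se' // mulr0 addr0.
    have : `|z n * e' i| <= 1.
      have z0 : 0 < z n by rewrite divr_gt0 ?invr_gt0 ?ltr0n.
      rewrite normrM (gtr0_norm z0) -(mulVf (lt0r_neq0 M0)) ler_pM ?(ltW z0) //.
      by rewrite ler_pdivrMr ?ltr0n // ler_peMr ?invr_ge0 ?(ltW M0) // ler1n.
    by rewrite /b si ler_norml => /andP[+ _] /=; lra.
  - by move=> i si; rewrite sb // se' // mulr0 addr0.
  - by rewrite gcombD gcombZ.
apply: (@roots_geq_poly_eq0 _ _ [seq z n | n <- iota 0 (size (p' - q'))]).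
- by apply/allP => _ /mapP[n _ ->].
- rewrite map_inj_uniq ?iota_uniq // => n n'.
  move/(mulfI (invr_neq0 (lt0r_neq0 M0)))/invr_inj/eqP.
  by rewrite eqr_nat => /eqP[].
- by rewrite size_map size_iota.
Qed.

Section PiecewiseEvaluation.
Variables (R : realType) (F : fan_data R).
Implicit Types f g : PP F.

Lemma pp_sumE (J : Type) (r : seq J) (P : pred J) (h : J -> PP F) x :
  (\sum_(j <- r | P j) h j) x = \sum_(j <- r | P j) h j x.
Proof. exact: (big_morph (fun f : PP F => f x) (id1 := 0) (op1 := +%R)). Qed.

Lemma pp_prodE (J : Type) (r : seq J) (P : pred J) (h : J -> PP F) x :
  (\prod_(j <- r | P j) h j) x = \prod_(j <- r | P j) h j x.
Proof. exact: (big_morph (fun f : PP F => f x) (id1 := 1) (op1 := *%R)). Qed.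

Lemma ppP f : piecewise_polynomial f.
Proof. by case: f => f /= /asboolP. Qed.

Definition mk_pp (f : fspace F -> R) (pf : piecewise_polynomial f) : PP F :=
  MkPP (introT (asboolP _) pf).

Lemma support_cone s x : s \in cones F -> cone_pts s x -> support F x.
Proof. by move=> sF sx; exists s. Qed.

Lemma chow_class_eq f g : {in support F, forall x, f x = g x} ->
  chow_class f = chow_class g.
Proof.
move=> fg; apply/chow_classE/asboolP; exists [::] => x sx.
by rewrite big_nil; change (f x - g x = 0); rewrite fg ?subrr ?inE.
Qed.

Lemma pp_deg_const c : pp_deg (F := F) 0 (pp_const F c).
Proof. by move=> s _; exists (fun=> c); split=> // [|c' x];
  [constructor|rewrite mul1r]. Qed.

Lemma pp_degD k f g : pp_deg k f -> pp_deg k g -> pp_deg k (f + g).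
Proof.
move=> hf hg s sF; have [p [pp fp ph]] := hf s sF; have [q [qp gq qh]] := hg s sF.
exists (p + q); split=> [|x sx|c x]; first exact: polynomial_add.
  by rewrite !fctE -fp // -gq.
by rewrite !fctE ph qh mulrDr.
Qed.

Lemma pp_degM j k f g : pp_deg j f -> pp_deg k g -> pp_deg (j + k) (f * g).
Proof.
move=> hf hg s sF; have [p [pp fp ph]] := hf s sF; have [q [qp gq qh]] := hg s sF.
exists (p * q); split=> [|x sx|c x]; first exact: polynomial_mul.
  by rewrite !fctE -fp // -gq.
by rewrite !fctE ph qh exprD; ring.
Qed.

End PiecewiseEvaluation.

(** * Courant functions generate the piecewise polynomials *)

Section Courant.
Variables (R : realType) (F : fan_data R).
Local Notation N := (fspace F).
Local Notation I := (ray F).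
Implicit Types (s t : {set I}) (a : I -> R).

(** The values at x of all Courant functions at once; off the support they default to 0. *)
Definition ray_coord (x : N) : I -> R :=
  xget (fun=> 0) [set a | exists2 s, s \in cones F &
    [/\ forall i, 0 <= a i, supp_in s a & x = gcomb F a]].

Hypothesis UF : unique_coords F.

Lemma ray_coord_gcomb s a : s \in cones F -> (forall i, 0 <= a i) -> supp_in s a ->
  ray_coord (gcomb F a) = a.
Proof.
move=> sF a0 sa; rewrite /ray_coord; case: xgetP => [b _ [t tF [b0 tb ab]]|/(_ a)[]].
  by apply/funext => i; rewrite (coords_inj UF sF tF a0 b0 sa tb ab).
by exists s.
Qed.

Lemma ray_coordP s x : s \in cones F -> cone_pts s x ->
  [/\ forall i, 0 <= ray_coord x i, supp_in s (ray_coord x) &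
    x = gcomb F (ray_coord x)].
Proof. by move=> sF /cone_ptsP[a [a0 sa ->]]; rewrite (ray_coord_gcomb sF). Qed.

Lemma ray_coordZ x c i : support F x -> 0 <= c ->
  support F (c *: x) /\ ray_coord (c *: x) i = c * ray_coord x i.
Proof.
move=> [s sF /(ray_coordP sF)[x0 sx xE]] c0.
have sa : supp_in s (fun i => c * ray_coord x i) by move=> j /sx->; rewrite mulr0.
have a0 j : 0 <= c * ray_coord x j by rewrite mulr_ge0.
rewrite [in c *: x]xE -gcombZ (ray_coord_gcomb sF) //; split=> //.
by exists s => //; apply/cone_ptsP; exists (fun i => c * ray_coord x i).
Qed.

Lemma ray_coord_deg s i : s \in cones F ->
  exists p, [/\ polynomial_fun p, forall x, cone_pts s x -> ray_coord x i = p x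
              & forall c x, p (c *: x) = c ^+ 1 * p x].
Proof.
move=> sF; have [m mE] := dual_form UF i sF; exists m; split=> [|x sx|c x].
- exact: polynomial_lin.
- have [_ rs xE] := ray_coordP sF sx.
  by rewrite [in m x]xE (dual_form_gcomb mE).
- by rewrite linearZ expr1.
Qed.

Lemma ray_coord_pp i : piecewise_polynomial (ray_coord^~ i).
Proof. by move=> s /(ray_coord_deg i)[p [hp pE _]]; exists p. Qed.

Definition xray i : PP F := mk_pp (ray_coord_pp i).

Lemma xrayE i x : xray i x = ray_coord x i.
Proof. by []. Qed.

Lemma xray_deg i : pp_deg 1 (xray i).
Proof. by move=> s /(ray_coord_deg i). Qed.

Lemma gen_gcomb j : gen F j = gcomb F (fun k => (k == j)%:R).
Proof.
rewrite /gcomb (bigD1 j) //= eqxx scale1r big1 ?addr0 // => k /negPf->.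
by rewrite scale0r.
Qed.

Lemma ray_coord_gen i j : [set j]%SET \in cones F ->
  ray_coord (gen F j) i = (i == j)%:R.
Proof.
move=> jF; rewrite gen_gcomb (ray_coord_gcomb jF) // => k.
by rewrite finset.in_set1 => /negPf->.
Qed.

Lemma xray_courant i : courant i (xray i).
Proof. by split; [exact: xray_deg | move=> j /(ray_coord_gen i)]. Qed.

Definition mono (w : seq I) : PP F := \prod_(i <- w) xray i.

Definition mono_sum (r : seq (R * seq I)) : PP F :=
  \sum_(u <- r) pp_const F u.1 * mono u.2.

Lemma monoE w x : mono w x = \prod_(i <- w) ray_coord x i.
Proof. by rewrite pp_prodE. Qed.

Lemma mono_sumE r x :
  mono_sum r x = \sum_(u <- r) u.1 * \prod_(i <- u.2) ray_coord x i.
Proof. by rewrite pp_sumE; apply: eq_bigr => u _; rewrite -monoE. Qed.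

Lemma mono_deg w : pp_deg (size w) (mono w).
Proof.
rewrite /mono; elim: w => [|i w IH]; first by rewrite big_nil;
  exact: (@pp_deg_const R F 1).
by rewrite big_cons; exact: (pp_degM (xray_deg i) IH).
Qed.

Definition is_mono_sum (h : N -> R) := exists r, h =1 mono_sum r.

Lemma is_mono_sum_const c : is_mono_sum (fun=> c).
Proof. by exists [:: (c, [::])] => x; rewrite mono_sumE big_seq1 big_nil mulr1. Qed.

Lemma is_mono_sum_xray i : is_mono_sum (ray_coord^~ i).
Proof. by exists [:: (1, [:: i])] => x; rewrite mono_sumE !big_seq1 mul1r. Qed.

Lemma is_mono_sumD g h : is_mono_sum g -> is_mono_sum h -> is_mono_sum (g + h).
Proof.
move=> [r gr] [r' hr]; exists (r ++ r') => x.
by rewrite mono_sumE big_cat /= -!mono_sumE -gr -hr.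
Qed.

Lemma is_mono_sumM g h : is_mono_sum g -> is_mono_sum h -> is_mono_sum (g * h).
Proof.
move=> [r gr] [r' hr]; exists [seq (u.1 * v.1, u.2 ++ v.2) | u <- r, v <- r'] => x.
rewrite mono_sumE big_allpairs_dep /= !fctE gr hr !mono_sumE mulr_suml.
apply: eq_bigr => u _; rewrite mulr_sumr; apply: eq_bigr => v _.
by rewrite big_cat /=; ring.
Qed.

(* For x in a cone t, the truncation of x to s lies in the face s :&: t.       *)
Definition truncate s (x : N) : N := \sum_(i in s) ray_coord x i *: gen F i.

Lemma truncate_polynomial s p : polynomial_fun p -> is_mono_sum (p \o truncate s).
Proof.
elim=> {p} [c|m|p q _ IHp _ IHq|p q _ IHp _ IHq].
- exact: is_mono_sum_const.
- have -> : m \o truncate s = \sum_(i in s) (fun x => ray_coord x i) * (fun=>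
  m (gen F i)).
    apply/funext => x; rewrite fct_sumE /= linear_sum.
    by apply: eq_bigr => i _; rewrite linearZ.
  elim/big_ind: _ => [|g h|i _]; first exact: is_mono_sum_const.
    exact: is_mono_sumD.
  by apply: is_mono_sumM; [exact: is_mono_sum_xray | exact: is_mono_sum_const].
- exact: is_mono_sumD.
- exact: is_mono_sumM.
Qed.

Lemma truncate_cone s t x : t \in cones F -> cone_pts t x ->
  cone_pts (s :&: t)%SET (truncate s x).
Proof.
move=> tF /(ray_coordP tF)[x0 tx _]; exists (ray_coord x) => //.
rewrite /truncate (bigID (mem t)) /= [X in _ + X]big1 ?addr0 => [|i /andP[_ /tx->]].
  by apply: eq_bigl => i; rewrite inE.
by rewrite scale0r.
Qed.

Lemma truncate_id s x : s \in cones F -> cone_pts s x -> truncate s x = x.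
Proof. by move=> sF /(ray_coordP sF)[_ sx xE]; rewrite [RHS]xE (gcomb_in sx). Qed.

(** The cones are treated one at a time. On a new cone s the error is a polynomial p, and adding p
    composed with the truncation to s removes it. A cone t treated before is not disturbed, since
    the truncation of its points lands in the face [s :&: t], where the error was already zero. *)
Lemma pp_mono_sum (f : PP F) : exists r, {in support F, forall x, f x = mono_sum r x}.
Proof.
suff [r rP] : exists r, forall s, s \in enum (mem (cones F)) ->
  forall x, cone_pts s x -> f x = mono_sum r x.
  by exists r => x; rewrite inE => -[s sF]; apply: rP; rewrite mem_enum.
have : {subset enum (mem (cones F)) <= cones F} by move=> s; rewrite mem_enum.
elim: (enum _) => [|s L IH] LF; first by exists [::].
have sF : s \in cones F by apply: LF; rewrite mem_head.
have [|r rP] := IH; first by move=> t tL; apply: LF; rewrite in_cons tL orbT.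
have [p hp pE] := ppP (f - mono_sum r) sF.
have [r' r'P] := truncate_polynomial s hp.
exists (r ++ r') => t tL x tx.
have tF : t \in cones F by exact: LF.
have -> : mono_sum (r ++ r') x = mono_sum r x + (f (truncate s x) - mono_sum r
  (truncate s x)).
  rewrite mono_sumE big_cat /= -!mono_sumE -r'P /= -pE //.
  exact: cone_pts_sub (finset.subsetIl _ _) (truncate_cone s tF tx).
move: tL; rewrite in_cons => /orP[/eqP ts|tL].
  by rewrite truncate_id -?ts // addrC subrK.
rewrite [f (truncate s x)](rP t) // ?subrr ?addr0; first exact: (rP t).
exact: cone_pts_sub (finset.subsetIr _ _) (truncate_cone s tF tx).
Qed.

Lemma pp_deg_mono_sum k (f : PP F) : pp_deg k f ->
  exists r, all (fun u : R * seq I => size u.2 == k) r /\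
    {in support F, forall x, f x = mono_sum r x}.
Proof.
move=> fk; have [r rP] := pp_mono_sum f.
exists [seq u <- r | size u.2 == k]; split=> [|x xF]; first exact: filter_all.
have [s sF sx] := set_mem xF; have [p [hp fp ph]] := fk s sF.
(* At a natural number n this is n^k f(x) minus the monomial expansion of f(n x), which vanishes by
   homogeneity. Hence q = 0, and its coefficient of degree k says that the monomials of degree k
   already sum to f(x). *)
pose q : {poly R} := f x *: 'X^k - \sum_(u <- r) (mono_sum [:: u] x) *: 'X^(size u.2).
have q0 : q = 0.
  apply: (@roots_geq_poly_eq0 _ _ [seq n%:R | n <- iota 0 (size q)]).
  - apply/allP => _ /mapP[n _ ->]; rewrite /root /q !hornerE horner_sum.
    have sZ : cone_pts s (n%:R *: x).
      have /cone_ptsP[a [a0 sa ->]] := sx; apply/cone_ptsP.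
      exists (fun i => n%:R * a i); split=> [i|i /sa->|]; last by rewrite gcombZ.
        by rewrite mulr_ge0.
      by rewrite mulr0.
    have -> : f x * n%:R ^+ k = f (n%:R *: x) by rewrite !fp // ph mulrC.
    rewrite rP ?inE; last exact: support_cone sZ.
    rewrite mono_sumE subr_eq0; apply/eqP/eq_bigr => u _.
    rewrite !hornerE mono_sumE big_seq1 -mulrA; congr (_ * _).
    elim: u.2 => [|i w IH]; first by rewrite !big_nil mul1r.
    rewrite !big_cons IH exprS; have [_ ->] := ray_coordZ i (support_cone sF sx) (ler0n
      R n).
    ring.
  - by rewrite map_inj_uniq ?iota_uniq // => n n' /eqP; rewrite eqr_nat => /eqP.
  - by rewrite size_map size_iota.
have := congr1 (coefp k) q0; rewrite /= coefB coefZ coefXn eqxx mulr1 coef0.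
move/eqP; rewrite subr_eq0 => /eqP ->; rewrite coef_sum mono_sumE big_filter.
rewrite [RHS]big_mkcond /=; apply: eq_bigr => u _.
rewrite coefZ coefXn mono_sumE big_seq1 eq_sym; case: eqP => _;
  by rewrite ?mulr1 ?mulr0.
Qed.

End Courant.

(** * Restriction to a star *)

Section LinearIdeal.
Variables (R : realType) (F : fan_data R).
Implicit Types f g : fspace F -> R.

Lemma linear_ideal_eq f g :
  {in support F, f =1 g} -> linear_ideal F f -> linear_ideal F g.
Proof. by move=> fg [r fr]; exists r => x xF; rewrite -fg ?inE // fr. Qed.

Lemma linear_ideal0 f : {in support F, forall x, f x = 0} -> linear_ideal F f.
Proof. by move=> f0; exists [::] => x xF; rewrite big_nil f0 ?inE. Qed.

Lemma linear_idealD f g :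
  linear_ideal F f -> linear_ideal F g -> linear_ideal F (fun x => f x + g x).
Proof.
by move=> [r fr] [r' gr']; exists (r ++ r') => x xF; rewrite big_cat /= -fr // -gr'.
Qed.

Lemma linear_idealM (h : PP F) f :
  linear_ideal F f -> linear_ideal F (fun x => h x * f x).
Proof.
move=> [r fr]; exists [seq (h * u.1, u.2) | u <- r] => x xF.
by rewrite fr // big_map mulr_sumr; apply: eq_bigr => u _; rewrite mulrA.
Qed.

Lemma linear_idealB f g :
  linear_ideal F f -> linear_ideal F g -> linear_ideal F (fun x => f x - g x).
Proof.
move=> hf /(linear_idealM (pp_const F (-1)))/(linear_idealD hf).
by apply: linear_ideal_eq => x _; rewrite /= mulN1r.
Qed.

Lemma linear_ideal_lin (m : {scalar fspace F}) : linear_ideal F m.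
Proof. by exists [:: (1, m)] => x _; rewrite big_seq1 mul1r. Qed.

End LinearIdeal.

Lemma polynomial_comp (R : realType) (V W : vectType R) (phi : {linear V -> W}) p :
  polynomial_fun p -> polynomial_fun (p \o phi).
Proof.
elim=> {p} [c|m|p q _ IHp _ IHq|p q _ IHp _ IHq].
- exact: polynomial_const.
- exact: (polynomial_lin (m \o phi : {scalar _})).
- exact: polynomial_add.
- exact: polynomial_mul.
Qed.

Section Pullback.
Variables (R : realType) (F G : fan_data R) (phi : {linear fspace F -> fspace G}).
Hypothesis phi_cones : forall s, s \in cones F ->
  exists2 t, t \in cones G & forall x, cone_pts s x -> cone_pts t (phi x).

Lemma support_pullback x : support F x -> support G (phi x).
Proof. by move=> [s /phi_cones[t tG st] /st]; exists t. Qed.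

Lemma piecewise_polynomial_pullback f :
  piecewise_polynomial (F := G) f -> piecewise_polynomial (F := F) (f \o phi).
Proof.
move=> fG s /phi_cones[t /fG[p hp fp] st]; exists (p \o phi);
  first exact: polynomial_comp.
by move=> x /st /fp.
Qed.

Definition pp_pullback (f : PP G) : PP F := mk_pp (piecewise_polynomial_pullback (ppP
  f)).

Lemma pp_deg_pullback k (f : PP G) : pp_deg k f -> pp_deg k (pp_pullback f).
Proof.
move=> fk s /phi_cones[t /fk[p [hp fp ph]] st]; exists (p \o phi); split.
- exact: polynomial_comp.
- by move=> x /st /fp.
- by move=> c x /=; rewrite linearZ ph.
Qed.

Lemma linear_ideal_pullback f : linear_ideal G f -> linear_ideal F (f \o phi).
Proof.
move=> [r fr]; exists [seq (pp_pullback u.1, (u.2 \o phi : {scalar fspace F})) | u : PP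
  G * {scalar fspace G} <- r] => x xF.
by rewrite big_map /= fr //; exact: support_pullback.
Qed.

End Pullback.

(** * The projection onto the model of N / U *)

Section QuotientProjection.
Variables (R : fieldType) (N : vectType R) (U : {vspace N}).

HB.instance Definition _ := GRing.Linear.copy (@quotv_proj R N U)
  (vsproj (U^C)%VS \o daddv_pi (U^C)%VS U).

Let compl : (U^C :&: U = 0)%VS. Proof. by rewrite capvC capv_compl. Qed.

Lemma quotv_projK : cancel (vsval : quotv U -> N) (quotv_proj U).
Proof. by move=> y; rewrite /quotv_proj daddv_pi_id ?vsvalK // subvsP. Qed.

Lemma quotv_proj_eq0 x : (quotv_proj U x == 0) = (x \in U).
Proof.
apply/eqP/idP => [/(congr1 vsval)|xU].
  rewrite /quotv_proj vsprojK ?memv_pi // linear0 => p0.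
  have xs : x \in (U^C + U)%VS by rewrite addvC addv_complf memvf.
  by rewrite -(daddv_pi_add compl xs) p0 add0r memv_pi.
have xs : x \in (U^C + U)%VS by rewrite addvC addv_complf memvf.
have := daddv_pi_add compl xs; rewrite (daddv_pi_id _ xU) ?capv_compl //.
by move/(canRL (addrK x)); rewrite subrr /quotv_proj => ->; rewrite linear0.
Qed.

Lemma vsval_quotv_proj x : vsval (quotv_proj U x) - x \in U.
Proof. by rewrite -quotv_proj_eq0 linearB /= quotv_projK subrr. Qed.

End QuotientProjection.

Section Star.
Variables (R : realType) (F : fan_data R) (s : {set ray F}).
Local Notation N := (fspace F).
Local Notation I := (ray F).
Local Notation K := (closed_star s).
Local Notation S := (star s).
Local Notation prj := (quotv_proj (cone_span s)).
Implicit Types (t : {set I}) (a b : I -> R).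

Lemma star_conesP t' : reflect
  (exists t, [/\ t \in cones F, s \subset t & t' = (t :\: s)%SET]) (t' \in cones S).
Proof.
apply: (iffP imsetP) => [[t]|[t [tF st ->]]]; last by exists t => //; rewrite inE tF.
by rewrite inE => /andP[tF st] ->; exists t.
Qed.

Lemma gcomb_star a : gcomb S a = prj (gcomb F a).
Proof. by rewrite /gcomb linear_sum; apply: eq_bigr => i _; rewrite linearZ. Qed.

Lemma prj_gen i : i \in s -> prj (gen F i) = 0.
Proof.
move=> si; apply/eqP; rewrite quotv_proj_eq0 memv_span //.
by apply/mapP; exists i => //; rewrite mem_enum.
Qed.

Lemma cone_pts_prj t x : cone_pts t x -> cone_pts (F := S) (t :\: s)%SET (prj x).
Proof.
move=> /cone_ptsP[a [a0 ta ->]]; rewrite -gcomb_star.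
exists a => //; rewrite /gcomb (bigID (mem (t :\: s)%SET)) /= [X in _ + X]big1 ?addr0
  // => i.
rewrite finset.in_setD negb_and negbK => /orP[si|/ta->]; last by rewrite scale0r.
by rewrite prj_gen // scaler0.
Qed.

Lemma support_star x : support K x -> support S (prj x).
Proof.
move=> [t]; rewrite inE => /andP[tF stF] tx; exists ((s :|: t) :\: s)%SET.
  by apply/star_conesP; exists (s :|: t)%SET; split=> //; exact: finset.subsetUl.
by apply: cone_pts_prj; apply: cone_pts_sub tx; exact: finset.subsetUr.
Qed.

Lemma cone_support_closed_star t x :
  t \in cones F -> s \subset t -> cone_pts t x -> support K x.
Proof.
by move=> tF st tx; exists t => //; rewrite inE tF (finset.setUidPr st).
Qed.

Lemma cone_span_sub t : s \subset t -> (cone_span s <= cone_span t)%VS.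
Proof.
move=> /fintype.subsetP st; apply: sub_span => _ /mapP[i si ->]; apply/mapP;
  exists i => //.
by move: si; rewrite !mem_enum; apply: st.
Qed.

Lemma vsval_cone_span t y : s \subset t ->
  cone_pts (F := S) (t :\: s)%SET y -> vsval y \in cone_span t.
Proof.
move=> st /cone_ptsP[a [a0 ta ->]]; rewrite gcomb_star.
rewrite -[vsval _](subrK (gcomb F a)) memvD //.
  exact: (subvP (cone_span_sub st)) (vsval_quotv_proj _ _).
apply/cone_spanP; exists a => // i it; apply: ta.
by rewrite finset.in_setD negb_and it orbT.
Qed.

Hypothesis UF : unique_coords F.

Lemma closed_star_unique_coords : s \in cones F -> unique_coords K.
Proof.
move=> sF; split=> [|t u|t u a b].
- by rewrite inE (coords_set0 UF) finset.setU0 sF.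
- rewrite !inE => /andP[tF stF] ut; rewrite (coords_face UF tF ut).
  by rewrite (coords_face UF stF) // finset.setUS.
- by rewrite !inE => /andP[tF _] /andP[uF _]; exact: (coords_inj UF tF uF).
Qed.

Lemma star_unique_coords : s \in cones F -> unique_coords S.
Proof.
move=> sF; split=> [|t u|t u a b].
- by apply/star_conesP; exists s; rewrite finset.setDv.
- move=> /star_conesP[v [vF sv ->]] uv; apply/star_conesP; exists (u :|: s)%SET; split.
  + apply: (coords_face UF vF); rewrite finset.subUset sv andbT.
    exact: fintype.subset_trans uv (finset.subsetDl _ _).
  + exact: finset.subsetUr.
  + rewrite finset.setDUl finset.setDv finset.setU0; apply/esym/finset.setDidPl.
    by move: uv; rewrite finset.subsetD => /andP[].
- move=> /star_conesP[v [vF sv ->]] /star_conesP[w [wF sw ->]] a0 b0 va wb.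
  rewrite !gcomb_star => /eqP; rewrite -subr_eq0 -linearB quotv_proj_eq0.
  move=> /cone_spanP[e se eE].
  (* The two points of F differ by an element of span(s) with coefficients e. Moving its negative
     part to one side and its positive part to the other gives two nonnegative expressions of a
     single point. *)
  pose a' i := a i + Num.max (- e i) 0; pose b' i := b i + Num.max (e i) 0.
  have abe : gcomb F a' = gcomb F b'.
    apply/eqP; rewrite -subr_eq0 -gcombB -(subrr (gcomb F e)) -[X in X - _]eE -gcombB
      -gcombB.
    apply/eqP/eq_bigr => i _; congr (_ *: _); rewrite /a' /b'.
    by case: (ltrgtP (- e i) 0) => h; case: (ltrgtP (e i) 0) => h'; lra.
  have ab' : a' =1 b'.
    apply: (coords_inj UF vF wF) abe => [i|i|i iv|i iw].
    + by rewrite addr_ge0 // le_max lexx orbT.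
    + by rewrite addr_ge0 // le_max lexx orbT.
    + rewrite /a' va ?finset.in_setD ?negb_and ?iv ?orbT // se ?oppr0 ?maxxx ?addr0 //.
      by apply: contra iv; exact/fintype.subsetP.
    + rewrite /b' wb ?finset.in_setD ?negb_and ?iw ?orbT // se ?maxxx ?addr0 //.
      by apply: contra iw; exact/fintype.subsetP.
  move=> i; case: (boolP (i \in s)) => si.
    by rewrite va ?wb // finset.in_setD si.
  by have := ab' i; rewrite /a' /b' se // oppr0 maxxx !addr0.
Qed.

End Star.

(** * Existence and uniqueness of the restriction to a star *)

Section StarExtension.
Variables (R : realType) (F : fan_data R) (s : {set ray F}).
Hypotheses (UF : unique_coords F) (sF : s \in cones F).
Local Notation N := (fspace F).
Local Notation I := (ray F).
Local Notation K := (closed_star s).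
Local Notation S := (star s).
Local Notation prj := (quotv_proj (cone_span s)).
Implicit Types (t : {set I}) (f : N -> R) (g : fspace S -> R).

Let UK : unique_coords K := closed_star_unique_coords UF sF.
Let US : unique_coords S := star_unique_coords UF sF.

(* On the cones containing s, the function g is f evaluated, by polynomial     *)
(* continuation, on the complement of span(s) that models N / span(s).         *)
Definition star_ext f g := forall t, t \in cones F -> s \subset t ->
  exists p, [/\ polynomial_fun p, forall x, cone_pts t x -> f x = p x
    & forall y, cone_pts (F := S) (t :\: s)%SET y -> g y = p (vsval y)].

(** Polynomials agreeing on a cone t agree on its span, which contains the representatives in N of
    the points of the cone [t :\: s] of the star. *)
Lemma star_ext_unique f f' g g' : star_ext f g -> star_ext f' g' ->
  {in support K, f =1 f'} -> {in support S, g =1 g'}.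
Proof.
move=> fg fg' ff' y /set_mem[_ /star_conesP[t [tF st ->]] ty].
have [p [hp fp ->//]] := fg t tF st; have [q [hq fq ->//]] := fg' t tF st.
apply: (polynomial_cone_span hp hq) (vsval_cone_span st ty) => x tx.
by rewrite -fp // -fq // ff' // inE; exact: (cone_support_closed_star tF st).
Qed.

Lemma star_ext_eq f f' g : {in support K, f =1 f'} -> star_ext f g -> star_ext f' g.
Proof.
move=> ff' fg t tF st; have [p [hp fp gp]] := fg t tF st; exists p; split=> // x tx.
by rewrite -ff' ?fp // inE; exact: (cone_support_closed_star tF st).
Qed.

Lemma star_ext_const c : star_ext (fun=> c) (fun=> c).
Proof. by move=> t _ _; exists (fun=> c); split=> //; exact: polynomial_const. Qed.

Lemma star_ext_linear (m : {scalar N}) : star_ext m (m \o vsval).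
Proof. by move=> t _ _; exists m; split=> //; exact: polynomial_lin. Qed.

Lemma star_extD f f' g g' : star_ext f g -> star_ext f' g' ->
  star_ext (fun x => f x + f' x) (fun y => g y + g' y).
Proof.
move=> fg fg' t tF st; have [p [hp fp gp]] := fg t tF st.
have [q [hq fq gq]] := fg' t tF st; exists (p + q); split=> [|x tx|y ty].
- exact: polynomial_add.
- by rewrite fp // fq.
- by rewrite gp // gq.
Qed.

Lemma star_extM f f' g g' : star_ext f g -> star_ext f' g' ->
  star_ext (fun x => f x * f' x) (fun y => g y * g' y).
Proof.
move=> fg fg' t tF st; have [p [hp fp gp]] := fg t tF st.
have [q [hq fq gq]] := fg' t tF st; exists (p * q); split=> [|x tx|y ty].
- exact: polynomial_mul.
- by rewrite fp // fq.
- by rewrite gp // gq.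
Qed.

Lemma star_ext_sum (J : Type) (r : seq J) (f : J -> N -> R) (g : J -> fspace S -> R) :
  (forall j, star_ext (f j) (g j)) ->
  star_ext (fun x => \sum_(j <- r) f j x) (fun y => \sum_(j <- r) g j y).
Proof.
move=> fg; elim: r => [|j r IH].
  rewrite [X in star_ext X](_ : _ = fun=> 0); last by apply/funext => x;
    rewrite big_nil.
  rewrite [X in star_ext _ X](_ : _ = fun=> 0); last by apply/funext => x;
    rewrite big_nil.
  exact: star_ext_const.
rewrite [X in star_ext X](_ : _ = fun x => f j x + \sum_(j <- r) f j x); last first.
  by apply/funext => x; rewrite big_cons.
rewrite [X in star_ext _ X](_ : _ = fun x => g j x + \sum_(j <- r) g j x); last first.
  by apply/funext => x; rewrite big_cons.
exact: star_extD.
Qed.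

Lemma star_ext_prj (g : PP S) : star_ext (g \o prj) g.
Proof.
move=> t tF st.
have [|p hp gp] := @ppP _ _ g (t :\: s)%SET; first by apply/star_conesP; exists t.
exists (p \o prj); split=> [|x tx|y ty /=].
- exact: polynomial_comp.
- by rewrite /= gp //; exact: cone_pts_prj.
- by rewrite gp // quotv_projK.
Qed.

Lemma star_ext_xray j : j \notin s -> star_ext (xray UF j) (xray US j).
Proof.
move=> js t tF st; have [m mE] := dual_form UF j tF.
have tS : (t :\: s)%SET \in cones S by apply/star_conesP; exists t.
exists m; split=> [|x tx|y ty]; first exact: polynomial_lin.
  have [_ xt xE] := ray_coordP UF tF tx.
  by rewrite [in m x]xE (dual_form_gcomb mE).
have [y0 yt yE] := ray_coordP US tS ty.
rewrite xrayE -[vsval y](subrK (gcomb F (ray_coord y))) linearD /=.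
have /cone_spanP[e se ->] : vsval y - gcomb F (ray_coord y) \in cone_span s.
  by rewrite [in vsval y]yE gcomb_star vsval_quotv_proj.
rewrite !(dual_form_gcomb mE) ?se ?add0r //.
  by move=> i it; apply: yt; rewrite finset.in_setD negb_and it orbT.
by move=> i it; apply: se; apply: contra it; exact/fintype.subsetP.
Qed.

(** For a ray i of s, the Courant function x_i is congruent modulo the linear function m to a
    combination of the x_j with j outside s, and these restrict to Courant functions of the star. *)
Lemma star_ext_xray_in i : i \in s -> exists2 m : {scalar N},
  star_ext (xray UF i) (fun y => - \sum_(j | j \notin s) m (gen F j) * xray US j y) &
  {in support K, forall x,
    m x = xray UF i x + \sum_(j | j \notin s) m (gen F j) * xray UF j x}.
Proof.
move=> si; have [m mE mval] : exists2 m : {scalar N}, forall k, k \in s ->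
  m (gen F k) = (k == i)%:R
    & forall y : subvs_of (cone_span s)^C, m (vsval y) = 0.
  have [m mE] := dual_form UF i sF.
  exists (m \o daddv_pi (cone_span s) (cone_span s)^C%VS : {scalar N}) => [k ks|y] /=.
    rewrite daddv_pi_id ?capv_compl ?mE // memv_span //.
    by apply/mapP; exists k => //; rewrite mem_enum.
  have := daddv_pi_add (capv_compl (cone_span s)) (_ : vsval y \in (_ + _)%VS).
  rewrite addv_complf memvf => /(_ isT).
  rewrite (daddv_pi_id _ (subvsP y)); last by rewrite capvC capv_compl.
  by move/(canRL (addrK (vsval y))); rewrite subrr => ->; rewrite linear0.
have mgcomb a : m (gcomb F a) = a i + \sum_(j | j \notin s) m (gen F j) * a j.
  rewrite gcomb_linear (bigID (mem s)) /= (bigD1 i) //= mE // eqxx mulr1 [X in _ + X +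
    _]big1 ?addr0.
    by congr (_ + _); apply: eq_bigr => j _; rewrite mulrC.
  by move=> k /andP[ks /negPf ki]; rewrite mE // ki mulr0.
exists m => [t tF st|x /set_mem[t]]; last first.
  rewrite inE => /andP[tF _] tx; have [_ _ xE] := ray_coordP UF tF tx.
  by rewrite [in m x]xE mgcomb.
have [p pE] := dual_form UF i tF.
have tS : (t :\: s)%SET \in cones S by apply/star_conesP; exists t.
exists p; split=> [|x tx|y ty]; first exact: polynomial_lin.
  have [_ xt xE] := ray_coordP UF tF tx.
  by rewrite [in p x]xE (dual_form_gcomb pE).
have [y0 yt yE] := ray_coordP US tS ty.
have ytF : supp_in t (ray_coord y).
  by move=> j jt; apply: yt; rewrite finset.in_setD negb_and jt orbT.
have /cone_spanP[e se eE] : vsval y - gcomb F (ray_coord y) \in cone_span s.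
  by rewrite [in vsval y]yE gcomb_star vsval_quotv_proj.
have ste : supp_in t e.
  by move=> j jt; apply: se; apply: contra jt; exact/fintype.subsetP.
have valy : vsval y = gcomb F (fun j => e j + ray_coord y j).
  by rewrite gcombD -eE subrK.
have ysi : ray_coord y i = 0 by apply: yt; rewrite finset.in_setD si.
rewrite valy (dual_form_gcomb pE) ?ysi ?addr0; last by move=> j jt;
  rewrite ste // ytF // addr0.
have := mval y; rewrite valy mgcomb ysi addr0 => /eqP; rewrite addr_eq0 => /eqP->.
congr (- _); apply: eq_bigr => j js; by rewrite (se _ js) add0r.
Qed.

Lemma pp_closed_star f : piecewise_polynomial (F := F) f ->
  piecewise_polynomial (F := K) f.
Proof. by move=> fF t; rewrite inE => /andP[tF _]; exact: fF. Qed.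

Let pp_sub (f : PP F) : PP K := @mk_pp R K f (pp_closed_star (ppP f)).

Lemma linear_ideal_closed_star f : linear_ideal F f -> linear_ideal K f.
Proof.
move=> [r fr]; exists [seq (pp_sub u.1, u.2) | u <- r] => x [t].
by rewrite inE big_map => /andP[tF _] tx; apply: fr; exists t.
Qed.

(** Continuation to the star together with the congruence that defines [chow_restr]. Both are stable
    under sums and products, so it suffices to check constants and Courant functions. *)
Definition star_retract f := exists2 g : PP S, star_ext f g &
  linear_ideal K (fun x => f x - g (prj x)).

Lemma ray_coord_prj j x : j \notin s -> support K x ->
  ray_coord (F := S) (prj x) j = ray_coord (F := F) x j.
Proof.
move=> js [t]; rewrite inE => /andP[tF stF] /(ray_coordP UF tF)[x0 tx xE].
pose a i := if i \in s then 0 else ray_coord (F := F) x i.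
have tS : ((s :|: t) :\: s)%SET \in cones S.
  by apply/star_conesP; exists (s :|: t)%SET; split=> //; exact: finset.subsetUl.
have pE : prj x = gcomb S a.
  rewrite [in prj x]xE -gcomb_star; apply: eq_bigr => i _; rewrite /a.
  case: (boolP (i \in s)) => [si|_]; last by [].  
  by rewrite [gen S i](prj_gen (F := F) si : gen S i = 0) !scaler0.
rewrite pE (ray_coord_gcomb US tS) => [|i|i].
- by rewrite /a (negPf js).
- by rewrite /a; case: ifP.
- rewrite finset.in_setD finset.in_setU negb_and negbK /a.
  by case: ifP => //= _ /tx.
Qed.

Lemma xray_closed_star i : {in support K, xray UF i =1 xray UK i}.
Proof.
move=> x /set_mem[t tK /cone_ptsP[a [a0 ta ->]]].
have tF : t \in cones F by move: tK; rewrite inE => /andP[].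
transitivity (a i); first exact: (congr1 (@^~ i) (ray_coord_gcomb UF tF a0 ta)).
exact: (congr1 (@^~ i) (esym (ray_coord_gcomb UK tK a0 ta))).
Qed.

Lemma star_retract_const c : star_retract (fun=> c).
Proof.
exists (pp_const S c); first exact: star_ext_const.
by apply: linear_ideal0 => x _; rewrite /= subrr.
Qed.

Lemma star_retractD f f' : star_retract f -> star_retract f' ->
  star_retract (fun x => f x + f' x).
Proof.
move=> [g fg fgI] [g' fg' fgI']; exists (g + g'); first exact: star_extD.
apply: linear_ideal_eq (linear_idealD fgI fgI') => x _ /=.
by change (f x - g (prj x) + (f' x - g' (prj x)) = f x + f' x - (g (prj x) + g' (prj
  x))); ring.
Qed.

Definition star_proj : {linear fspace K -> fspace S} :=
  (quotv_proj (cone_span s) : {linear N -> quotv (cone_span s)}).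

Lemma star_phi_cones t : t \in cones K ->
  exists2 u, u \in cones S & forall x, cone_pts t x -> cone_pts u (star_proj x).
Proof.
rewrite inE => /andP[tF stF]; exists ((s :|: t) :\: s)%SET.
  by apply/star_conesP; exists (s :|: t)%SET; split=> //; exact: finset.subsetUl.
by move=> x /(cone_pts_sub (finset.subsetUr s t)); exact: cone_pts_prj.
Qed.

Lemma star_retractM (f f' : PP K) : star_retract f -> star_retract f' ->
  star_retract (f * f').
Proof.
move=> [g fg fgI] [g' fg' fgI']; exists (g * g'); first exact: star_extM.
have h1 := linear_idealM f fgI'.
have h2 := linear_idealM (@pp_pullback R K S star_proj star_phi_cones g') fgI.
apply: linear_ideal_eq (linear_idealD h1 h2) => x _ /=.
by change (f x * (f' x - g' (prj x)) + g' (prj x) * (f x - g (prj x)) =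
  f x * f' x - g (prj x) * g' (prj x)); ring.
Qed.

Lemma star_retract_eq f f' : {in support K, f =1 f'} -> star_retract f ->
  star_retract f'.
Proof.
move=> ff' [g fg fgI]; exists g; first exact: star_ext_eq fg.
by apply: linear_ideal_eq fgI => x xK; rewrite ff'.
Qed.

Lemma star_retract_xray i : star_retract (xray UK i).
Proof.
apply: (star_retract_eq (xray_closed_star i)).
case: (boolP (i \in s)) => si; last first.
  exists (xray US i); first exact: star_ext_xray.
  apply: linear_ideal0 => x /set_mem xK.
  by rewrite !xrayE ray_coord_prj // subrr.
have [m fg mE] := star_ext_xray_in si.
pose g : PP S := \sum_(j | j \notin s) pp_const S (m (gen F j)) * xray US j.
have gE y : (- g) y = - \sum_(j | j \notin s) m (gen F j) * xray US j y.
  by transitivity (- g y) => //; rewrite pp_sumE.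
exists (- g); first by have -> : pp_fun (- g) = _ := funext gE.
apply: (@linear_ideal_eq R K m); last exact: (@linear_ideal_lin R K m).
move=> x xK.
rewrite mE // gE opprK; congr (_ + _); apply: eq_bigr => j js.
by rewrite !xrayE ray_coord_prj //; exact: set_mem.
Qed.

Lemma star_retract_pp (f : PP K) : star_retract f.
Proof.
have [r rE] := pp_mono_sum UK f.
apply: (@star_retract_eq (mono_sum UK r)) => [x xK|]; first by rewrite rE.
rewrite /mono_sum; elim: r {rE} => [|u r IH]; first by rewrite big_nil;
  exact: star_retract_const.
rewrite big_cons; apply: star_retractD => //; apply: star_retractM;
  first exact: star_retract_const.
rewrite /mono; elim: u.2 => [|i w IHw]; first by rewrite big_nil;
  exact: star_retract_const.
by rewrite big_cons; apply: star_retractM => //; exact: star_retract_xray.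
Qed.

(** Pullback from the Chow ring of the star to that of the closed star is injective: a relation
    upstairs is carried to the star coefficient by coefficient, by continuation to the
    complement. *)
Lemma linear_ideal_star (g : PP S) : linear_ideal K (g \o prj) -> linear_ideal S g.
Proof.
move=> [r rE]; have /choice[E EP] (u : PP K) : exists g' : PP S, star_ext u g'.
  by have [g' ? _] := star_retract_pp u; exists g'.
exists [seq (E u.1, (u.2 \o vsval : {scalar fspace S})) | u : PP K * {scalar fspace K}
  <- r] => y yS.
rewrite big_map.
have h : star_ext (fun x => \sum_(u <- r) u.1 x * u.2 x)
    (fun y => \sum_(u <- r) E u.1 y * u.2 (vsval y)).
  apply: star_ext_sum => u; apply: star_extM; first exact: EP.
  exact: (star_ext_linear u.2).
by apply: (star_ext_unique (star_ext_prj g) h _ (mem_set yS)) => x /set_mem; exact: rE.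
Qed.

Lemma star_ext_ideal f (g : PP S) : piecewise_polynomial (F := K) f -> star_ext f g ->
  linear_ideal K (fun x => f x - g (prj x)).
Proof.
move=> fK fg; have [g' fg' fgI'] := star_retract_pp (mk_pp fK).
apply: linear_ideal_eq fgI' => x /set_mem xK /=.
by rewrite (star_ext_unique fg' fg) // inE; exact: support_star.
Qed.

Lemma star_ext_exists (f : PP F) : exists g : PP S, star_ext f g.
Proof. by have [g fg _] := star_retract_pp (pp_sub f); exists g. Qed.

(** The congruence in [chow_restr] admits a single class, by injectivity of the pullback, so the
    class chosen there is the one obtained by continuation. *)
Lemma chow_restrE (f : PP F) (g : PP S) :
  star_ext f g -> chow_restr s (chow_class f) = chow_class g.
Proof.
move=> fg; have fgI : linear_ideal K (fun x => f x - g (prj x)).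
  exact: (star_ext_ideal (ppP (pp_sub f))).
rewrite /chow_restr; case: xgetP => [b _ [f' [g' [ff' ->
  fgI']]]|/(_ (chow_class g))[]]; last first.
  by exists f, g.
apply/chow_classE/asboolP/linear_ideal_star.
have /chow_classE/asboolP/linear_ideal_closed_star ffI := ff'.
apply: linear_ideal_eq (linear_idealB (linear_idealB fgI fgI') ffI) => x _ /=.
by change (f x - g (prj x) - (f' x - g' (prj x)) - (f x - f' x) = g' (prj x) - g (prj
  x)); ring.
Qed.

Lemma chow_restrP (f : PP F) (g : PP S) :
  chow_restr s (chow_class f) = chow_class g <->
  linear_ideal K (fun x => f x - g (prj x)).
Proof.
have [g0 fg0] := star_ext_exists f.
have fgI0 := star_ext_ideal (ppP (pp_sub f)) fg0.
rewrite (chow_restrE fg0) chow_classE; split=> [/asboolP gI|fgI].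
  have := linear_idealD fgI0 (@linear_ideal_pullback R K S star_proj star_phi_cones _
    gI).
  apply: linear_ideal_eq => x _ /=.
  by change (f x - g0 (prj x) + (g0 (prj x) - g (prj x)) = f x - g (prj x)); ring.
apply/asboolP/linear_ideal_star; apply: linear_ideal_eq (linear_idealB fgI fgI0) =>
  x _ /=.
by change (f x - g (prj x) - (f x - g0 (prj x)) = g0 (prj x) - g (prj x)); ring.
Qed.

End StarExtension.

(** * The graded Chow ring and its generators *)

Section ChowRing.
Variables (R : realType) (F : fan_data R).
Implicit Types (a b : chow F) (f g : PP F).

Lemma chow_scalerAl c a b : c *: (a * b) = (c *: a) * b.
Proof. exact: mulrA. Qed.

Lemma chow_scalerAr c a b : c *: (a * b) = a * (c *: b).
Proof. by rewrite mulrC chow_scalerAl mulrC. Qed.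

Lemma chow_classZ c f : c *: chow_class f = chow_class (pp_const F c * f).
Proof. exact: chow_classM. Qed.

Lemma chow_class_prod (J : Type) (r : seq J) (h : J -> PP F) :
  chow_class (\prod_(j <- r) h j) = \prod_(j <- r) chow_class (h j).
Proof.
apply: (big_morph (@chow_class R F) (id1 := 1) (op1 := *%R)) => // f g.
by rewrite -chow_classM.
Qed.

Lemma chow_class0 : chow_class 0 = 0 :> chow F.
Proof. by apply: (addrI (chow_class 0)); rewrite -chow_classD !addr0. Qed.

Lemma chow_class_sum (J : Type) (r : seq J) (h : J -> PP F) :
  chow_class (\sum_(j <- r) h j) = \sum_(j <- r) chow_class (h j).
Proof. exact: (big_morph (@chow_class R F) (@chow_classD R F) chow_class0). Qed.

Lemma chow_deg0 k : chow_deg (F := F) k 0.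
Proof.
exists 0; last exact: chow_class0; move=> s _; exists (fun=> 0); split=> //.
  exact: polynomial_const.
by move=> c x; rewrite mulr0.
Qed.

Lemma chow_degD k a b : chow_deg k a -> chow_deg k b -> chow_deg k (a + b).
Proof.
move=> [f fk <-] [g gk <-]; exists (f + g); first exact: pp_degD.
exact: chow_classD.
Qed.

Lemma chow_degM j k a b : chow_deg j a -> chow_deg k b -> chow_deg (j + k) (a * b).
Proof.
move=> [f fk <-] [g gk <-]; exists (f * g); first exact: pp_degM.
by rewrite -chow_classM.
Qed.

Lemma chow_degZ k c a : chow_deg k a -> chow_deg k (c *: a).
Proof.
move=> [f fk <-]; rewrite chow_classZ; exists (pp_const F c * f) => //.
exact: (pp_degM (@pp_deg_const R F c) fk).
Qed.

Lemma chow_degB k a b : chow_deg k a -> chow_deg k b -> chow_deg k (a - b).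
Proof. by move=> ak bk; rewrite -scaleN1r; apply: chow_degD => //;
  exact: chow_degZ. Qed.

Lemma chow_deg_sum k (J : Type) (r : seq J) (P : pred J) (h : J -> chow F) :
  (forall j, P j -> chow_deg k (h j)) -> chow_deg k (\sum_(j <- r | P j) h j).
Proof. by move=> hk; elim/big_ind: _ => //; [exact: chow_deg0 | exact: chow_degD]. Qed.

Lemma chow_deg1 : chow_deg (F := F) 0 1.
Proof. by exists 1 => // s sF; exact: (@pp_deg_const R F 1). Qed.

Lemma chow_deg_prod n (l : 'I_n -> chow F) :
  (forall i, chow_deg 1 (l i)) -> chow_deg n (\prod_i l i).
Proof.
elim: n l => [l _|n IH l l1]; first by rewrite big_ord0; exact: chow_deg1.
by rewrite big_ord_recl; apply: (chow_degM (l1 _)); exact: IH.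
Qed.

Hypothesis UF : unique_coords F.

Definition chow_ray i : chow F := chow_class (xray UF i).

Lemma chow_class_mono w : chow_class (mono UF w) = \prod_(i <- w) chow_ray i.
Proof. exact: chow_class_prod. Qed.

Lemma chow_prod_ray_deg w : chow_deg (size w) (\prod_(i <- w) chow_ray i).
Proof. by rewrite -chow_class_mono; exists (mono UF w) => //; exact: mono_deg. Qed.

Lemma chow_deg_spanned k a : chow_deg k a ->
  exists c : k.-tuple (ray F) -> R, a = \sum_w c w *: \prod_(i <- w) chow_ray i.
Proof.
move=> [f fk <-]; have [r [rk fr]] := pp_deg_mono_sum UF fk.
rewrite (chow_class_eq fr) /mono_sum chow_class_sum;
  elim: r rk {fr} => [_|u r IH /= /andP[uk rk]].
  by exists (fun=> 0); rewrite big_nil big1 // => w _; rewrite scale0r.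
have [c cE] := IH rk; exists (fun w => c w + (w == Tuple uk)%:R * u.1).
rewrite big_cons cE -chow_classZ chow_class_mono.
under [RHS]eq_bigr do rewrite scalerDl; rewrite big_split /= addrC; congr (_ + _).
rewrite (bigD1 (Tuple uk)) //= eqxx mul1r [X in _ = _ + X]big1 ?addr0 // => w /negPf->.
by rewrite mul0r scale0r.
Qed.

(** Pulls one Courant function out of a class of positive degree, which is how statements about A
    are reduced to the stars of rays. *)
Lemma chow_deg_rays k a : chow_deg k.+1 a ->
  exists b : ray F -> chow F, (forall i, chow_deg k (b i)) /\ a = \sum_i chow_ray i * b
    i.
Proof.
move=> /chow_deg_spanned[c ->].
elim/big_ind: _ => [|a1 a2 [b1 [h1 ->]] [b2 [h2 ->]]|w _].
- exists (fun=> 0); split=> [i|]; first exact: chow_deg0.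
  by rewrite big1 // => i _; rewrite mulr0.
- exists (fun i => b1 i + b2 i); split=> [i|]; first exact: chow_degD.
  by rewrite -big_split; apply: eq_bigr => i _; rewrite mulrDr.
case/tupleP: w => i w; exists (fun j => if j == i then c [tuple of i :: w] *: \prod_(j
  <- w) chow_ray j else 0).
split=> [j|].
  case: ifP => _; last exact: chow_deg0.
  by apply: chow_degZ; rewrite -[X in chow_deg X](size_tuple w);
    exact: chow_prod_ray_deg.
rewrite (bigD1 i) //= eqxx [X in _ = _ + X]big1 ?addr0 => [|j /negPf->];
  last by rewrite mulr0.
by rewrite big_cons chow_scalerAr.
Qed.

Lemma xray_not_cone i : [set i]%SET \notin cones F ->
  {in support F, forall x, ray_coord x i = 0}.
Proof.
move=> iF x /set_mem[s sF] /(ray_coordP UF sF)[_ sx _]; apply: sx.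
by apply: contra iF => si; apply: (coords_face UF sF); rewrite finset.sub1set.
Qed.

Lemma chow_ray_not_cone i : [set i]%SET \notin cones F -> chow_ray i = 0.
Proof.
by move=> iF; rewrite -chow_class0; apply: chow_class_eq => x /(xray_not_cone iF).
Qed.

Lemma pp_deg1E g : pp_deg 1 g ->
  {in support F, forall x, g x = \sum_(i | [set i]%SET \in cones F) g (gen F i) *
    ray_coord x i}.
Proof.
move=> /(pp_deg_mono_sum UF)[r [r1 gr]].
have [c cE] : exists c : ray F -> R, forall x,
  mono_sum UF r x = \sum_i c i * ray_coord x i.
  elim: r r1 {gr} => [_|u r IH /= /andP[u1 /IH[c cE]]].
    by exists (fun=> 0) => x; rewrite mono_sumE big_nil big1 // => i _; rewrite mul0r.
  case: u u1 => k [//|j [|//]] _; exists (fun i => c i + (i == j)%:R * k) => x.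
  rewrite mono_sumE big_cons /= -mono_sumE cE addrC.
  under [RHS]eq_bigr do rewrite mulrDl; rewrite big_split /=; congr (_ + _).
  rewrite (bigD1 j) //= eqxx mul1r big_seq1 big1 ?addr0 // => i /negPf->.
  by rewrite !mul0r.
move=> x xF; rewrite gr // cE (bigID (fun i => [set i]%SET \in cones F)) /=.
rewrite [X in _ + X]big1 ?addr0 => [|i iF]; last by rewrite (xray_not_cone iF) // mulr0.
apply: eq_bigr => i iF; congr (_ * _).
have gi : cone_pts [set i]%SET (gen F i).
  by exists (fun=> 1) => //; rewrite big_set1 scale1r.
rewrite gr ?inE; last exact: support_cone gi.
rewrite cE (bigD1 i) //= (ray_coord_gen UF) // eqxx mulr1 big1 ?addr0 // => j /negPf ji.
by rewrite (ray_coord_gen UF) // ji mulr0.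
Qed.

End ChowRing.

(** * Restriction as a graded ring homomorphism *)

Section Restriction.
Variables (R : realType) (F : fan_data R) (s : {set ray F}).
Hypotheses (UF : unique_coords F) (sF : s \in cones F).
Local Notation S := (star s).
Local Notation US := (star_unique_coords UF sF).
Local Notation restr := (@chow_restr R F s).
Implicit Types a b : chow F.

Lemma chow_restr_class a : exists (f : PP F) (g : PP S),
  [/\ a = chow_class f, restr a = chow_class g & star_ext (s := s) f g].
Proof.
have [g fg] := star_ext_exists UF sF (repr a); exists (repr a), g; split=> //.
  by rewrite chow_reprK.
by rewrite -[in LHS](chow_reprK a); exact: chow_restrE.
Qed.

Lemma chow_restrD a b : restr (a + b) = restr a + restr b.
Proof.
have [f [g [-> -> fg]]] := chow_restr_class a;
  have [f' [g' [-> -> fg']]] := chow_restr_class b.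
rewrite -!chow_classD; apply: chow_restrE => //; exact: star_extD.
Qed.

Lemma chow_restrM a b : restr (a * b) = restr a * restr b.
Proof.
have [f [g [-> -> fg]]] := chow_restr_class a;
  have [f' [g' [-> -> fg']]] := chow_restr_class b.
rewrite [LHS](congr1 restr (chow_classM f f')) [RHS](chow_classM g g').
by apply: chow_restrE => //; exact: star_extM.
Qed.

Lemma chow_restr1 : restr 1 = 1.
Proof. by apply: (@chow_restrE _ _ _ UF sF 1 1); exact: star_ext_const. Qed.

Lemma chow_restrZ c a : restr (c *: a) = c *: restr a.
Proof.
rewrite [LHS]chow_restrM; congr (_ * _).
by apply: (@chow_restrE _ _ _ UF sF (pp_const F c) (pp_const S c));
  exact: star_ext_const.
Qed.

Lemma chow_restr0 : restr 0 = 0.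
Proof. by rewrite -(scale0r 0) chow_restrZ scale0r. Qed.

Lemma chow_restr_prod (J : Type) (r : seq J) (h : J -> chow F) :
  restr (\prod_(j <- r) h j) = \prod_(j <- r) restr (h j).
Proof. exact: (big_morph restr chow_restrM chow_restr1). Qed.

(** The continued polynomial agrees with the homogeneous one on the cone t, hence on its span, where
    the representatives of the star live. *)
Lemma chow_restr_deg k a : chow_deg k a -> chow_deg k (restr a).
Proof.
move=> [f fk <-]; have [g fg] := star_ext_exists UF sF f.
rewrite (chow_restrE UF sF fg); exists g => // t' /star_conesP[t [tF st ->]].
have [p [hp fp gp]] := fg t tF st; have [q [hq fq qk]] := fk t tF.
exists (q \o vsval); split=> [|y ty|c y /=]; last exact: qk.
  exact: (polynomial_comp (vsval : {linear quotv (cone_span s) -> fspace F})).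
rewrite gp //; apply: (polynomial_cone_span hp hq) (vsval_cone_span st ty) => x tx.
by rewrite -fp // fq.
Qed.

Lemma chow_restr_ray j : j \notin s -> restr (chow_ray UF j) = chow_ray US j.
Proof. by move=> js; apply: chow_restrE => //; exact: star_ext_xray. Qed.

End Restriction.

(* A linear ideal relation on the closed star of i extends by zero after       *)
(* multiplication by the Courant function of i.                                *)
Lemma chow_ray_restr0 (R : realType) (F : fan_data R) (UF : unique_coords F) i
    (iF : [set i]%SET \in cones F) a :
  chow_restr [set i]%SET a = 0 -> chow_ray UF i * a = 0.
Proof.
move=> ra; have : chow_restr [set i]%SET (chow_class (repr a)) = chow_class 0.
  by rewrite chow_reprK chow_class0.
move/(chow_restrP UF iF) => [r rE].
rewrite -(chow_reprK a) [LHS]chow_classM -chow_class0; apply/chow_classE/asboolP.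
have upp (u : PP (closed_star [set i]%SET)) :
    piecewise_polynomial (F := F) (fun x => xray UF i x * u x).
  (* On a cone t outside the closed star of i, the ray i is not in t, so the Courant function
     vanishes there and the product is the zero polynomial. *)
  move=> t tF; have [itF|itF] := boolP ((i |: t)%SET \in cones F).
    have [|p hp up] := @ppP _ _ u t; first by rewrite inE tF.
    have [q hq iq] := ppP (xray UF i) tF; exists (q * p); first exact: polynomial_mul.
    by move=> x tx; rewrite iq // up.
  exists (fun=> 0) => [|x tx]; first exact: polynomial_const.
  have [_ xt _] := ray_coordP UF tF tx; rewrite xrayE xt ?mul0r //.
  by apply: contra itF => it; rewrite (finset.setUidPr _) // finset.sub1set.
exists [seq (@mk_pp R F _ (upp u.1), u.2 : {scalar fspace F}) | u <- r] => x xF.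
rewrite big_map; change (xray UF i x * repr a x - 0 = \sum_(u <- r) xray UF i x * u.1 x
  * u.2 x).
rewrite subr0; under eq_bigr do rewrite -mulrA; rewrite -mulr_sumr.
have [s sF sx] := xF; have [is_|is_] := boolP (i \in s).
  congr (_ * _); rewrite -rE; first by change (repr a x = repr a x - 0); rewrite subr0.
  apply: (cone_support_closed_star sF) sx; by rewrite finset.sub1set.
by have [_ xt _] := ray_coordP UF sF sx; rewrite xrayE xt // !mul0r.
Qed.

(** * Ample classes *)

Lemma gen_neq0 (R : realType) (F : fan_data R) (UF : unique_coords F) i :
  [set i]%SET \in cones F -> gen F i != 0.
Proof.
move=> iF; apply/eqP => g0; have : (i == i)%:R = 0 :> R.
  apply: (cone_indep UF iF (e := fun k => (k == i)%:R)); last by rewrite -gen_gcomb.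
  by move=> j; rewrite finset.in_set1 => /negPf->.
by move/eqP; rewrite eqxx oner_eq0.
Qed.

Section Ample.
Variables (R : realType) (F : fan_data R).
Hypothesis UF : unique_coords F.
Implicit Types (l : chow F) (s t : {set ray F}).

(** Convexity of the ample cone keeps the segments from the l_i to l_0 inside it. *)
Lemma ample_comb c c' l l' : 0 <= c -> 0 <= c' -> 0 < c + c' -> ample l -> ample l' ->
  ample (c *: l + c' *: l').
Proof.
move=> c0 c0' cc [l1 lp] [l1' lp']; split=> [|s sF].
  by apply: chow_degD; exact: chow_degZ.
have [g [g1 lg gp]] := lp s sF; have [g' [g1' lg' gp']] := lp' s sF.
exists (pp_const _ c * g + pp_const _ c' * g'); split.
- by apply: pp_degD; exact: (pp_degM (pp_deg_const _)).
- by rewrite chow_restrD // !chow_restrZ // lg lg' !chow_classZ -chow_classD.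
- move=> x xS x0; change (0 < c * g x + c' * g' x).
  have [c0e|cn0] := eqVneq c 0.
    by rewrite c0e mul0r add0r mulr_gt0 ?gp' //; move: cc; rewrite c0e add0r.
  apply: ltr_pwDl; last by apply: mulr_ge0 => //; exact/ltW/gp'.
  by apply: mulr_gt0; [rewrite lt_def cn0 | exact: gp].
Qed.

Let idK s : {linear fspace F -> fspace (closed_star s)} := (idfun : {linear fspace F ->
  fspace F}).

Lemma linear_ideal_closed_star0 f : linear_ideal (closed_star (F := F) finset.set0) f ->
  linear_ideal F f.
Proof.
apply: (@linear_ideal_pullback _ F (closed_star finset.set0) (idK _)) => s sF.
by exists s => //; rewrite inE sF finset.set0U.
Qed.

(** Positivity at the cone {0}: its star is F up to the model of N / 0, and a piecewise linear
    function is the combination of Courant functions whose coefficients are its values at the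
    generators. *)
Lemma ample_rays l : ample l -> exists2 c : ray F -> R,
  forall i, [set i]%SET \in cones F -> 0 < c i &
  l = \sum_(i | [set i]%SET \in cones F) c i *: chow_ray UF i.
Proof.
move=> [[f f1 <-] lp]; have s0F := coords_set0 UF.
have [g [g1 /(chow_restrP UF s0F)fgI gp]] := lp _ s0F.
have US := star_unique_coords UF s0F.
have starE i : [set i]%SET \in cones (star (F := F) finset.set0) = ([set i]%SET \in
  cones F).
  apply/star_conesP/idP => [[t [tF _]]|iF]; first by rewrite finset.setD0 => ->.
  by exists [set i]%SET; rewrite finset.setD0 finset.sub0set.
exists (fun i => g (gen (star (F := F) finset.set0) i)) => [i iF|].
  have iS : [set i]%SET \in cones (star (F := F) finset.set0) by rewrite starE.
  apply: gp; last exact: (gen_neq0 US iS).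
  exists [set i]%SET => //; exists (fun=> 1) => //; by rewrite big_set1 scale1r.
rewrite /chow_ray; under eq_bigr do rewrite chow_classZ;
  rewrite -big_filter -chow_class_sum big_filter.
apply/chow_classE/asboolP.
apply: linear_ideal_eq (linear_ideal_closed_star0 fgI) => x xF.
set h := \sum_(i <- _ | _) _; change (f x - g (quotv_proj (cone_span finset.set0) x) =
  f x - h x).
have xK : support (closed_star (F := F) finset.set0) x.
  by move/set_mem: xF => [s sF sx]; exists s => //; rewrite inE sF finset.set0U.
rewrite /h pp_sumE; congr (_ - _); rewrite (pp_deg1E US g1) ?inE;
  last exact: support_star.
apply: eq_big => [i|i iF]; first exact: starE.
by rewrite (ray_coord_prj UF s0F) ?inE.
Qed.

End Ample.

(** * The star of a star *)

Section StarOfStar.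
Variables (R : realType) (F : fan_data R) (s u : {set ray F}).
Hypotheses (UF : unique_coords F) (sF : s \in cones F) (uF : u \in cones F).
Hypothesis su : s \subset u.
Local Notation S := (star s).
Local Notation t := (u :\: s)%SET.
Local Notation S2 := (@star R S t).
Local Notation Su := (star u).
Local Notation prj_s := (quotv_proj (cone_span s)).
Local Notation prj_u := (quotv_proj (cone_span u)).
Local Notation prj_t := (quotv_proj (@cone_span R S t)).

Let N := fspace F.

Lemma setD_setD (v : {set ray F}) : (v :\: u)%SET = ((v :\: s) :\: t)%SET.
Proof.
apply/finset.setP => i; rewrite !inE; have := fintype.subsetP su i.
by case: (i \in s) => [->|_] //=; case: (i \in u).
Qed.

Lemma star_star_conesP w : reflect
  (exists v, [/\ v \in cones F, u \subset v & w = (v :\: u)%SET]) (w \in cones S2).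
Proof.
apply: (iffP (star_conesP _ _)) => [[v' [/star_conesP[v [vF sv ->]] tv ->]]|[v [vF uv
  ->]]].
  exists v; split=> //.
    apply/fintype.subsetP => i iu; have [/(fintype.subsetP sv)//|is_] := boolP (i \in
      s).
    by have /(fintype.subsetP tv) : i \in t; rewrite finset.in_setD ?is_ // => /andP[].
  exact/esym/setD_setD.
exists (v :\: s)%SET; split.
- by apply/star_conesP; exists v; split=> //; exact: fintype.subset_trans uv.
- exact: finset.setSD.
- exact: setD_setD.
Qed.

Lemma star_star_ker x : (prj_t (prj_s x) == 0) = (x \in cone_span u).
Proof.
rewrite quotv_proj_eq0; apply/cone_spanP/idP => [[e te]|/cone_spanP[e ue ->]].
  rewrite gcomb_star => /eqP; rewrite -subr_eq0 -linearB quotv_proj_eq0.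
  move=> /(subvP (cone_span_sub su)) xe; rewrite -(subrK (gcomb F e) x) memvD //.
  apply/cone_spanP; exists e => // i iu; apply: te.
  by rewrite finset.in_setD negb_and iu orbT.
exists (fun i => if i \in s then 0 else e i) => [i|].
  by rewrite finset.in_setD negb_and negbK; case: ifP => //= _ /ue.
rewrite -gcomb_star; apply: eq_bigr => i _; case: (boolP (i \in s)) => // si.
by rewrite [gen S i](prj_gen (F := F) si : gen S i = 0) !scaler0.
Qed.

(** The quotient by span(u) and the iterated quotient through span(s) are modelled by different
    complements. [star_star_to] and [star_star_from] compare them compatibly with the projections
    from N. *)
Definition star_star_to : {linear fspace S2 -> fspace Su} :=
  (prj_u \o (vsval : {linear quotv (cone_span s) -> N})
     \o (vsval : {linear quotv (@cone_span R S t) -> quotv (cone_span s)})).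

Definition star_star_from : {linear fspace Su -> fspace S2} :=
  (prj_t \o prj_s \o (vsval : {linear quotv (cone_span u) -> N})).

Lemma star_star_fromE x : star_star_from (prj_u x) = prj_t (prj_s x).
Proof.
rewrite /star_star_from /=; apply/eqP; rewrite -subr_eq0 -!linearB.
by rewrite star_star_ker vsval_quotv_proj.
Qed.

Lemma star_star_toE x : star_star_to (prj_t (prj_s x)) = prj_u x.
Proof.
rewrite /star_star_to /=; apply/eqP; rewrite -subr_eq0 -linearB quotv_proj_eq0.
by rewrite -star_star_ker !linearB /= !quotv_projK subrr.
Qed.

Lemma star_star_toK : cancel star_star_to star_star_from.
Proof.
by move=> y; rewrite -(quotv_projK y) -(quotv_projK (vsval y)) star_star_toE
  star_star_fromE.
Qed.

Lemma star_star_to_cones w : w \in cones S2 ->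
  exists2 w', w' \in cones Su & forall x, cone_pts w x -> cone_pts w' (star_star_to x).
Proof.
move=> /star_star_conesP[v [vF uv ->]]; exists (v :\: u)%SET;
  first by apply/star_conesP; exists v.
move=> x /cone_ptsP[a [a0 va ->]]; apply/cone_ptsP; exists a; split=> //.
rewrite !gcomb_star -star_star_toE; congr (star_star_to (prj_t _)); exact: gcomb_star.
Qed.

Lemma star_star_from_cones w : w \in cones Su ->
  exists2 w', w' \in cones S2 & forall x, cone_pts w x ->
    cone_pts w' (star_star_from x).
Proof.
move=> /star_conesP[v [vF uv ->]]; exists (v :\: u)%SET;
  first by apply/star_star_conesP; exists v.
move=> x /cone_ptsP[a [a0 va ->]]; apply/cone_ptsP; exists a; split=> //.
by rewrite gcomb_star star_star_fromE !gcomb_star.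
Qed.

(** The positive representative on the star of u is transported to the star of the star; what needs
    proof is that it represents the iterated restriction. *)
Lemma ample_star_rep (l : chow F) :
  (exists g : PP Su, [/\ pp_deg 1 g, chow_restr u l = chow_class g
     & forall x, support Su x -> x != 0 -> 0 < g x]) ->
  exists g : PP S2, [/\ pp_deg 1 g, chow_restr (F := S) t (chow_restr s l) = chow_class
    g
     & forall x, support S2 x -> x != 0 -> 0 < g x].
Proof.
move=> [g [g1 lg gp]]; exists (pp_pullback star_star_to_cones g); split.
- exact: pp_deg_pullback.
- have US := star_unique_coords UF sF.
  have tS : t \in cones S by apply/star_conesP; exists u.
  have [f [h [lE -> fh]]] := chow_restr_class UF sF l.
  have [g' hg'] := star_ext_exists US tS h.
  rewrite (chow_restrE US tS hg'); have /(chow_restrP US tS) hgI := chow_restrE US tS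
    hg'.
  have /(chow_restrP UF sF) fhI := chow_restrE UF sF fh.
  move: lg; rewrite {}lE => /(chow_restrP UF uF) fgI.
  pose idK : {linear fspace (closed_star u) -> fspace (closed_star s)} :=
    (idfun : {linear N -> N}).
  pose prjK : {linear fspace (closed_star u) -> fspace (@closed_star R S t)} :=
    (prj_s : {linear N -> quotv (cone_span s)}).
  have fhI' : linear_ideal (closed_star u) (fun x => f x - h (prj_s x)).
    apply: (@linear_ideal_pullback _ _ _ idK _ _ fhI) => w;
      rewrite inE => /andP[wF uwF].
    exists w => //; rewrite inE wF; apply: (coords_face UF uwF).
    exact: finset.setSU.
  have hgI' : linear_ideal (closed_star u) (fun x =>
    h (prj_s x) - g' (prj_t (prj_s x))).
    apply: (@linear_ideal_pullback _ _ _ prjK _ _ hgI) => w;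
      rewrite inE => /andP[wF uwF].
    have sub_sw : (s :|: w \subset u :|: w)%SET by exact: finset.setSU.
    exists ((s :|: w) :\: s)%SET; last first.
      by move=> x /(cone_pts_sub (finset.subsetUr s w)); exact: cone_pts_prj.
    rewrite inE; apply/andP; split; apply/star_conesP.
      exists (s :|: w)%SET; split=> //; first exact: (coords_face UF uwF).
      exact: finset.subsetUl.
    exists (u :|: w)%SET; split=> //.
      exact: fintype.subset_trans su (finset.subsetUl _ _).
    by apply/finset.setP => i; rewrite !inE; case: (i \in s); case: (i \in u).
  (* On the closed star of u, f is congruent to the pullbacks of g and of h, and the pullback of h
     to that of g'. So the pullbacks of g and g' are congruent, and injectivity of pullback descends
     this to the star of u. *)
  have : linear_ideal Su (pp_pullback star_star_from_cones g' - g).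
    apply: (linear_ideal_star UF uF).
    apply: linear_ideal_eq (linear_idealB (linear_idealB fgI fhI') hgI') => x _ /=.
    change (f x - g (prj_u x) - (f x - h (prj_s x)) - (h (prj_s x) - g' (prj_t (prj_s
      x))) =
      g' (star_star_from (prj_u x)) - g (prj_u x)).
    by rewrite star_star_fromE; ring.
  move=> /(linear_ideal_pullback star_star_to_cones) gI.
  apply/chow_classE/asboolP; apply: linear_ideal_eq gI => x _.
  change (g' (star_star_from (star_star_to x)) - g (star_star_to x) = g' x - g
    (star_star_to x)).
  by rewrite star_star_toK.
- move=> x xS x0; apply: gp; first exact: (support_pullback star_star_to_cones).
  by apply: contra_neq x0 => x0; rewrite -(star_star_toK x) x0 linear0.
Qed.

End StarOfStar.

Lemma ample_restr (R : realType) (F : fan_data R) (s : {set ray F}) (l : chow F) :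
  unique_coords F -> s \in cones F -> ample l -> ample (chow_restr s l).
Proof.
move=> UF sF [l1 lp]; split; first exact: chow_restr_deg.
move=> _ /star_conesP[u [uF su ->]].
by apply: (ample_star_rep UF sF uF su); exact: lp.
Qed.

(** * The mixed theorems *)

(** A spanning subfamily of minimal size is a basis. It supplies coordinates on each A^k, so that
    forms become matrices. *)
Lemma finite_span_basis (R : fieldType) (V : lmodType R) (J : finType) (e : J -> V) :
  exists m (b : 'I_m -> V), [/\ forall i, exists j, b i = e j,
    forall c : J -> R, exists v : 'rV[R]_m, \sum_j c j *: e j = \sum_i v 0 i *: b i
    & forall v : 'rV[R]_m, \sum_i v 0 i *: b i = 0 -> v = 0].
Proof.
pose spans (T : {set J}) := forall c : J -> R, exists2 c' : J -> R,
  forall j, j \notin T -> c' j = 0 & \sum_j c j *: e j = \sum_j c' j *: e j.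
have spansT : `[< spans [set: J]%SET >].
  by apply/asboolP => c; exists c => // j; rewrite inE.
case: (@arg_minnP _ [set: J]%SET (fun T => `[< spans T >]) (fun T : {set J} =>
  #|T|) spansT) => T /asboolP Tspan Tmin.
have comb (c : J -> R) : (forall j, j \notin T -> c j = 0) ->
    \sum_j c j *: e j = \sum_(i < #|T|) c (enum_val i) *: e (enum_val i).
  move=> cT; rewrite (bigID (mem T)) /= [X in _ + X]big1 => [|j /cT->];
    last by rewrite scale0r.
  by rewrite addr0 big_enum_val.
exists #|T|, (e \o enum_val); split=> [i|c|v v0].
- by exists (enum_val i).
- have [c' cT ->] := Tspan c; exists (\row_i c' (enum_val i)).
  by rewrite comb //; apply: eq_bigr => i _; rewrite mxE.
pose c j : R := if insub j : option {j | j \in T} is Some x then v 0 (enum_rank_in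
  (valP x) (val x)) else 0.
have cT j : j \notin T -> c j = 0 by move=> jT; rewrite /c insubF //; exact: negbTE.
have cE i : c (enum_val i) = v 0 i.
  by rewrite /c insubT ?enum_valP // => iT; rewrite /= enum_valK_in.
have c0 : \sum_j c j *: e j = 0.
  by rewrite comb // -[RHS]v0; apply: eq_bigr => i _; rewrite cE.
apply/rowP => i; rewrite mxE -cE; apply: contraTeq isT => ci0.
set j0 := enum_val i in ci0.
suff /asboolP/Tmin : spans (T :\ j0)%SET by rewrite [X in (X <= _)%N](cardsD1 j0)
  enum_valP ltnn.
(* A nontrivial relation c with c_j0 nonzero eliminates j0 from every combination, against
   minimality of T. *)
move=> c1; have [c2 c2T ->] := Tspan c1; exists (fun j => c2 j - c2 j0 / c j0 * c j) =>
  [j|].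
  rewrite !inE negb_and negbK => /orP[/eqP->|jT]; first by rewrite divfK ?subrr.
  by rewrite (c2T j jT) (cT j jT) mulr0 subr0.
under [RHS]eq_bigr do rewrite scalerBl -scalerA.
by rewrite sumrB -scaler_sumr c0 scaler0 subr0.
Qed.

(** * Gram matrices and Poincare duality *)

Section Gram.
Variables (R : realType) (F : fan_data R) (d : nat) (deg : {scalar chow F}).
Hypotheses (UF : unique_coords F) (PD : poincare_duality d deg).
Implicit Types (a b L : chow F).

Lemma chow_basis k : exists m (b : 'I_m -> chow F), [/\ forall i, chow_deg k (b i),
  forall a, chow_deg k a -> exists v : 'rV[R]_m, a = \sum_i v 0 i *: b i
  & forall v : 'rV[R]_m, \sum_i v 0 i *: b i = 0 -> v = 0].
Proof.
have [m [b [be bs bf]]] :=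
  finite_span_basis (fun w : k.-tuple (ray F) => \prod_(i <- w) chow_ray UF i).
exists m, b; split=> // [i|a].
  have [w ->] := be i; rewrite -[X in chow_deg X](size_tuple w).
  exact: chow_prod_ray_deg.
by move=> /(chow_deg_spanned UF)[c ->]; exact: bs.
Qed.

Definition gram L m (b : 'I_m -> chow F) : 'M[R]_m := \matrix_(i,
  j) deg (L * b i * b j).

Lemma gram_form L m (b : 'I_m -> chow F) (v w : 'rV_m) :
  mxform (gram L b) v w = deg (L * (\sum_i v 0 i *: b i) * (\sum_i w 0 i *: b i)).
Proof.
rewrite mxform_sum [L * _]mulr_sumr mulr_suml linear_sum; apply: eq_bigr => i _.
rewrite mulr_sumr linear_sum; apply: eq_bigr => j _.
by rewrite -2!chow_scalerAr -chow_scalerAl scalerA linearZ mxE [w 0 j * _]mulrC.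
Qed.

Lemma gram_sym L m (b : 'I_m -> chow F) : (gram L b)^T = gram L b.
Proof. by apply/matrixP => i j; rewrite !mxE mulrAC. Qed.

Variables (k n : nat) (L : chow F).
Hypotheses (dE : d = (n + k.*2)%N) (Ln : chow_deg n L)
  (Linj : forall a, chow_deg k a -> L * a = 0 -> a = 0).

Let k_le : (k <= d)%N. Proof. by rewrite dE -addnn addnA leq_addl. Qed.

Let La a : chow_deg k a -> chow_deg (d - k) (L * a).
Proof. by move=> /(chow_degM Ln); rewrite dE -addnn addnA addnK. Qed.

(** A vector in the kernel gives a class a with L a orthogonal to A^k; duality gives L a = 0, and
    injectivity of L gives a = 0. *)
Lemma gram_unit m (b : 'I_m -> chow F) :
  (forall i, chow_deg k (b i)) ->
  (forall a, chow_deg k a -> exists v : 'rV[R]_m, a = \sum_i v 0 i *: b i) ->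
  (forall v : 'rV[R]_m, \sum_i v 0 i *: b i = 0 -> v = 0) ->
  gram L b \in unitmx.
Proof.
move=> bk bs bf; rewrite -row_free_unit; apply/inj_row_free => v vG; apply: bf.
set a := \sum_i _; have ak : chow_deg k a by apply: chow_deg_sum => i _;
  exact: chow_degZ.
apply: Linj => //; have [_ PDk] := PD k_le; apply: PDk; first exact: La.
move=> a' /bs[v' ->]; rewrite mulrC -gram_form /mxform vG mul0mx mxE //.
Qed.

(** Surjectivity follows from injectivity because the Gram matrix is then invertible, without
    comparing dimensions of A^k and A^(d-k). *)
Lemma mul_iso_inj : mul_iso k (d - k) L.
Proof.
have [m [b [bk bs bf]]] := chow_basis k; have Gu := gram_unit bk bs bf.
split=> [a|a a' /set_mem ak /set_mem ak' LL|c ck]; first exact: La.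
  apply/eqP; rewrite -subr_eq0; apply/eqP/Linj; first exact: chow_degB.
  by rewrite mulrBr LL subrr.
(* The preimage a of c solves the linear system deg (L a b_j) = deg (c b_j); then L a - c is
   orthogonal to A^k, hence zero. *)
pose g : 'rV[R]_m := \row_j deg (c * b j); pose v := g *m invmx (gram L b).
set a := \sum_i v 0 i *: b i.
have ak : chow_deg k a by apply: chow_deg_sum => i _; exact: chow_degZ.
exists a => //; apply/eqP; rewrite -subr_eq0; apply/eqP.
have [_ PDk] := PD k_le; apply: PDk; first by apply: chow_degB => //; exact: La.
move=> a' /bs[w ->]; rewrite mulrC mulrBl linearB /= -gram_form /mxform mulmxKV //.
rewrite mulr_sumr linear_sum mxE; apply/eqP; rewrite subr_eq0; apply/eqP/eq_bigr => j _.
by rewrite !mxE -chow_scalerAr linearZ mulrC.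
Qed.

End Gram.

(** * Degree maps and their restriction to rays *)

Section Degree.
Variables (R : realType) (F : fan_data R) (d : nat).
Hypothesis UF : unique_coords F.
Implicit Types (w : {set ray F} -> R) (deg : {scalar chow F}).

Lemma chow_deg0_scalar a : chow_deg 0 a -> exists c : R, a = c *: (1 : chow F).
Proof.
move=> /(chow_deg_spanned UF)[c ->]; exists (\sum_w c w).
by rewrite scaler_suml; apply: eq_bigr => w _; rewrite tuple0 big_nil.
Qed.

(** A^d pairs perfectly with A^0, which consists of scalars, so a class of A^d is determined by its
    degree. *)
Lemma chow_top_line deg a0 a : poincare_duality d deg -> chow_deg d a0 ->
  chow_deg d a ->
  deg a0 != 0 -> a = (deg a / deg a0) *: a0.
Proof.
move=> PD a0d ad n0; apply/eqP; rewrite -subr_eq0; apply/eqP.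
have [_ PD0] := PD 0%N (leq0n d); apply: PD0.
  by rewrite subn0; apply: chow_degB => //; exact: chow_degZ.
move=> b /chow_deg0_scalar[c ->]; rewrite -chow_scalerAl mul1r linearZ /= linearB /=.
by rewrite linearZ /= divfK // subrr mulr0.
Qed.

Lemma degree_top_cone w deg t : fundamental_weight d w -> degree_map d w deg ->
  t \in cones F -> #|t| = d -> 0 < deg (\prod_(i in t) chow_ray UF i).
Proof.
move=> [_ wp _] wdeg tF td; have := wp t tF td.
rewrite -(wdeg t tF td (xray UF)) => [|i _]; last exact: xray_courant.
rewrite -big_enum chow_class_prod big_enum => h.
have m0 : 0 < (mult t)%:R :> R.
  by rewrite lt_def ler0n andbT; apply: contraTneq h => ->; rewrite mul0r ltxx.
by rewrite pmulr_rgt0 in h.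
Qed.

Lemma chow_prod_cone_deg (t : {set ray F}) : chow_deg #|t| (\prod_(i in t) chow_ray UF
  i).
Proof. by rewrite -big_enum cardE; exact: chow_prod_ray_deg. Qed.

Lemma top_cone_exists : fan_dim F = d -> exists2 t, t \in cones F & #|t| = d.
Proof.
move=> <-; have c0 : (0 < #|cones F|)%N.
  by apply/card_gt0P; exists finset.set0; exact: coords_set0.
by have [t tF tE] := eq_bigmax_cond (fun t : {set ray F} => #|t|) c0; exists t.
Qed.

End Degree.

Lemma lefschetz_coords (R : realType) (F : fan_data R) d : lefschetz F d ->
  unique_coords F.
Proof. by case=> w deg sF *; exact: simplicial_unique_coords. Qed.

Lemma lefschetz_ray (R : realType) (F : fan_data R) d i :
  lefschetz F d -> [set i]%SET \in cones F ->
  (0 < d)%N /\ lefschetz (star (F := F) [set i]%SET) d.-1.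
Proof.
move=> [w deg _ <- _ _ _ _ _ st] iF; split.
  by apply: leq_trans (leq_bigmax_cond _ iF); rewrite cards1.
by have := st _ iF; rewrite cards1 subn1; exact.
Qed.

(** Both sides depend only on the restriction of a, which lies on the line A^d of the star. They are
    compared on a monomial of a top cone through i, where both degrees are positive. *)
Lemma degree_ray (R : realType) (F : fan_data R) (UF : unique_coords F) d i w
    (deg : {scalar chow F}) w' (deg' : {scalar chow (star (F := F) [set i]%SET)}) :
  [set i]%SET \in cones F ->
  fundamental_weight d.+1 w -> degree_map d.+1 w deg ->
  fan_dim (star (F := F) [set i]%SET) = d ->
  fundamental_weight d w' -> degree_map d w' deg' -> poincare_duality d deg' ->
  exists2 c, 0 < c & forall a, chow_deg d a ->
    deg (chow_ray UF i * a) = c * deg' (chow_restr [set i]%SET a).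
Proof.
move=> iF fw dm dimS fw' dm' PD'; set S := star _ in deg' dimS fw' dm' PD' *.
pose US := star_unique_coords UF iF.
have [t' t'S t'd] := top_cone_exists US dimS.
have /star_conesP[t [tF it tE]] := t'S; have ti : i \in t by rewrite -finset.sub1set.
pose a0 := \prod_(j in t') chow_ray UF j.
have ia0 : chow_ray UF i * a0 = \prod_(j in t) chow_ray UF j.
  rewrite [RHS](bigD1 i) //=; congr (_ * _); apply: eq_bigl => j.
  by rewrite tE !inE andbC.
have Ra0 : chow_restr [set i]%SET a0 = \prod_(j in t') chow_ray US j.
  rewrite /a0 -!big_enum chow_restr_prod //= !big_enum; apply: eq_bigr => j jt'.
  by apply: chow_restr_ray; move: jt'; rewrite tE !inE => /andP[].
have td : #|t| = d.+1 by rewrite (cardsD1 i) ti -tE t'd.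
have p0 : 0 < deg (chow_ray UF i * a0) by rewrite ia0;
  exact: degree_top_cone fw dm tF td.
have p0' : 0 < deg' (chow_restr [set i]%SET a0) by rewrite Ra0;
  exact: degree_top_cone fw' dm' t'S t'd.
have a0d : chow_deg d a0 by rewrite -t'd; exact: chow_prod_cone_deg.
exists (deg (chow_ray UF i * a0) / deg' (chow_restr [set i]%SET a0));
  first exact: divr_gt0.
move=> a ad; set r := deg' (chow_restr _ a) / deg' (chow_restr [set i]%SET a0).
(* With r the ratio of the degrees on the star, this combination restricts to zero, so x_i kills it
   and deg (x_i a) = r deg (x_i a0). *)
have Ra : chow_restr [set i]%SET (a + (- r) *: a0) = 0.
  rewrite chow_restrD // chow_restrZ // scaleNr; apply/eqP; rewrite subr_eq0; apply/eqP.
  by apply: (chow_top_line US PD'); rewrite ?gt_eqF //; exact: chow_restr_deg.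
have /eqP := congr1 deg (chow_ray_restr0 UF iF Ra).
rewrite mulrDr linearD -chow_scalerAr scaleNr linearN linearZ linear0 /= subr_eq0 =>
  /eqP->.
by rewrite /r; field; rewrite gt_eqF.
Qed.

(** Write a as a sum of x_i b_i; the restriction of b_i lies above the dimension of the star and
    vanishes by induction, and in dimension 0 there are no rays. *)
Lemma lefschetz_chow_above (R : realType) (F : fan_data R) d (a : chow F) :
  lefschetz F d -> chow_deg d.+1 a -> a = 0.
Proof.
elim: d F a => [|d IH] F a lF; pose UF := lefschetz_coords lF.
  move=> /(chow_deg_rays UF)[b [bd ->]]; apply: big1 => i _.
  have [iF|iF] := boolP ([set i]%SET \in cones F);
    first by have [] := lefschetz_ray lF iF.
  by rewrite chow_ray_not_cone ?mul0r.
move=> /(chow_deg_rays UF)[b [bd ->]]; apply: big1 => i _.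
have [iF|iF] := boolP ([set i]%SET \in cones F);
  last by rewrite chow_ray_not_cone ?mul0r.
have [_ lS] := lefschetz_ray lF iF.
by apply: (chow_ray_restr0 UF iF); apply: IH => //; exact: chow_restr_deg.
Qed.

(** Naming the number n of classes, with d = n + 2k, avoids transporting families indexed by
    ['I_(d - k.*2)]. *)
Lemma mixed_HR_nat (R : realType) (F : fan_data R) d w (deg : {scalar chow F}) :
  mixed_HR F d -> fundamental_weight d w -> degree_map d w deg ->
  forall k n l0 (l : 'I_n -> chow F), d = (n + k.*2)%N -> ample l0 ->
    (forall i, ample (l i)) ->
    hr_positive deg k (l0 * \prod_i l i) (\prod_i l i).
Proof.
move=> H fw dm k n l0 l dE; have kd : (k.*2 <= d)%N by rewrite dE leq_addl.
have e : (d - k.*2)%N = n by rewrite dE addnK.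
by case: n / e l {dE} => l l0a la; exact: (H w deg).
Qed.

(** * Mixed hard Lefschetz from the stars *)

Section MixedHL.
Variables (R : realType) (F : fan_data R) (d : nat).
Hypotheses (lF : lefschetz F d)
  (starHR : forall i, [set i]%SET \in cones F ->
    mixed_HR (star (F := F) [set i]%SET) d.-1).

(** The class [l ord0] serves twice: expanded in Courant functions it produces the stars, and its
    restriction is the extra class that makes a restricted to each star primitive for the n
    remaining classes. *)
Lemma mixed_HL_inj k n (l : 'I_n -> chow F) a : d = (n + k.*2)%N ->
  (forall i, ample (l i)) -> chow_deg k a -> \prod_i l i * a = 0 -> a = 0.
Proof.
case: n l => [|n] l dE la ak; first by rewrite big_ord0 mul1r.
rewrite big_ord_recl => La0; have UF := lefschetz_coords lF.
have [c cp l0E] := ample_rays UF (la ord0).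
set L := \prod_(i < n) _ in La0.
have Ln : chow_deg n L by apply: chow_deg_prod => i; case: (la (lift ord0 i)).
have dn : d.-1 = (n + k.*2)%N by rewrite dE.
case: (lF) => w deg _ _ fw dm PD _ _ _.
pose q i := c i * ((-1) ^+ k * deg (chow_ray UF i * (L * a * a))).
have Laa : chow_deg d.-1 (L * a * a).
  by rewrite dn -addnn addnA; exact: (chow_degM (chow_degM Ln ak) ak).
(* Up to a positive factor, q_i is the Hodge-Riemann form of the star of i at the restriction of
   a. *)
have key i : [set i]%SET \in cones F -> 0 <= q i /\ (q i = 0 ->
  chow_restr [set i]%SET a = 0).
  move=> iF; have [d0 lS] := lefschetz_ray lF iF.
  case: (lS) => w' deg' _ dimS fw' dm' PD' _ _ _.
  have dS : d = d.-1.+1 by rewrite prednK.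
  have [|| c' c'0 c'E] := degree_ray UF iF (w := w) (deg := deg) _ _ dimS fw' dm' PD'.
  - by rewrite -dS.
  - by rewrite -dS.
  rewrite /q c'E // !chow_restrM // chow_restr_prod //.
  have [ra0|ran0] := eqVneq (chow_restr [set i]%SET a) 0.
    by rewrite ra0 mulr0 linear0 !mulr0.
  have := mixed_HR_nat (starHR iF) fw' dm' dn (ample_restr UF iF (la ord0))
    (fun j => ample_restr UF iF (la (lift ord0 j))).
  move=> /(_ _ (chow_restr_deg UF iF ak)); rewrite -chow_restr_prod // -!chow_restrM //.
  rewrite La0 chow_restr0 // => /(_ erefl ran0) pos.
  suff h : 0 < c i * ((-1) ^+ k * (c' * deg' (chow_restr [set i]%SET (L * a * a)))).
    by split=> [|h0]; [exact: ltW | move: h; rewrite h0 ltxx].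
  by rewrite [_ * (c' * _)]mulrCA; apply: mulr_gt0; [exact: cp | exact: mulr_gt0].
(* The sum reassembles [l ord0], giving the signed degree of [l ord0 * L * a * a], which is zero by
   assumption. *)
have q0 : \sum_(i | [set i]%SET \in cones F) q i = 0.
  rewrite /q; under eq_bigr do rewrite mulrCA -linearZ chow_scalerAl.
  rewrite -mulr_sumr -linear_sum -mulr_suml -l0E /=.
  by rewrite (_ : l ord0 * _ = 0) ?linear0 ?mulr0 // !mulrA La0 mul0r.
have x0 i : chow_ray UF i * a = 0.
  have [iF|/(chow_ray_not_cone UF)->] := boolP ([set i]%SET \in cones F);
    last by rewrite mul0r.
  apply: (chow_ray_restr0 UF iF); have [_ ] := key i iF; apply.
  move/eqP: q0; rewrite psumr_eq0 => [/allP/(_ i)|j /key[]//].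
  by rewrite mem_index_enum iF => /(_ isT)/eqP.
have kd : (k <= d)%N by rewrite dE -addnn addnA leq_addl.
have [PDk _] := PD k kd; apply: PDk => // b.
(* Here d - k = n + 1 + k is positive, so the test class b lies in the ideal of the x_i, all of
   which kill a. *)
rewrite dE -addnn addnA addnK => /(chow_deg_rays UF)[b' [_ ->]].
rewrite mulr_sumr big1 ?linear0 // => i _.
by rewrite mulrA [a * _]mulrC x0 mul0r.
Qed.

Lemma mixed_HL_of_star : mixed_HL F d.
Proof.
move=> k kd l la; case: (lF) => w deg _ _ fw dm PD _ _ _.
have dE : d = (d - k.*2 + k.*2)%N by rewrite subnK.
apply: (mul_iso_inj (lefschetz_coords lF) PD dE) => [|a ak].
  by apply: chow_deg_prod => i; case: (la i).
by apply: (mixed_HL_inj dE la ak).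
Qed.

End MixedHL.

(** * Mixed Hodge-Riemann by deformation *)

Lemma segment_prod_poly (R : realType) (F : fan_data R) (deg : {scalar chow F}) n
    (l0 : chow F) (l : 'I_n -> chow F) x :
  exists p : {poly R}, forall t,
    deg (\prod_i ((1 - t) *: l i + t *: l0) * x) = p.[t].
Proof.
elim: n l x => [|n IH] l x.
  by exists (deg x)%:P => t; rewrite big_ord0 mul1r hornerC.
have [p pE] := IH (fun i => l (lift ord0 i)) (l ord0 * x).
have [q qE] := IH (fun i => l (lift ord0 i)) (l0 * x).
exists ((1 - 'X) * p + 'X * q) => t.
rewrite big_ord_recl !hornerE -pE -qE mulrDl mulrDl linearD /=; congr (_ + _).
  by rewrite -!chow_scalerAl linearZ /= mulrCA mulrA.
by rewrite -!chow_scalerAl linearZ /= mulrCA mulrA.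
Qed.

Section MixedHR.
Variables (R : realType) (F : fan_data R) (d : nat).
Hypothesis lF : lefschetz F d.
Hypothesis HLinj : forall k n (l : 'I_n -> chow F) a, d = (n + k.*2)%N ->
  (forall i, ample (l i)) -> chow_deg k a -> \prod_i l i * a = 0 -> a = 0.

Let UF := lefschetz_coords lF.

Variable deg : {scalar chow F}.
Hypotheses (PD : poincare_duality d deg) (HR : hodge_riemann d deg).

(* A family u of degree k - 1 (empty for k = 0) such that the elements l0 * u  *)
(* span the complement of the primitive part of A^k, for each product L.       *)
Lemma primitive_complement k n (l0 : chow F) : d = (n + k.*2)%N -> ample l0 ->
  exists m (u : 'I_m -> chow F), [/\ forall j, chow_deg k (l0 * u j),
    forall L x, chow_deg n L -> chow_deg k x ->
      (forall j, deg (L * x * (l0 * u j)) = 0) -> l0 * L * x = 0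
    & forall (l : 'I_n -> chow F) (c : R), c != 0 -> (forall i, ample (l i)) ->
      gram deg ((c *: \prod_i l i) * l0 * l0) u \in unitmx].
Proof.
move=> dE l0a; have l01 : chow_deg 1 l0 by case: l0a.
case: k dE => [|k] dE.
  (* For k = 0 the complement is trivial: every class of A^0 is primitive because A^(d+1) = 0. *)
  exists 0, (fun=> 0); split=> [[]//|L x Ln x0 _|l c _ _].
    apply: (lefschetz_chow_above lF); have := chow_degM (chow_degM l01 Ln) x0.
    by rewrite dE /= !addn0.
  by rewrite unitmxE det_mx00 unitr1.
have dE' : d = (n.+2 + k.*2)%N by rewrite dE doubleS; lia.
have [m [u [uk us uf]]] := chow_basis UF k.
exists m, u; split=> [j|L x Ln xk Lx|l c c0 la].
- exact: (chow_degM l01 (uk j)).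
- have kd : (k <= d)%N by rewrite dE' -addnn addnA leq_addl.
  have [_ PDk] := PD kd; apply: PDk.
    have := chow_degM (chow_degM l01 Ln) xk; congr chow_deg.
    by rewrite dE'; lia.
  move=> a /us[v ->]; rewrite mulr_suml linear_sum big1 // => j _.
  rewrite -chow_scalerAl linearZ /= (_ : u j * _ = L * x * (l0 * u j)) ?Lx ?mulr0 //.
  by rewrite mulrC mulrA -(mulrA l0) [l0 * _]mulrC.
(* The family l with l_0 inserted twice. The Gram matrix in question is that of the product of these
   n + 2 classes, up to c, one degree lower, where mixed hard Lefschetz applies. *)
pose l' (i : 'I_n.+2) : chow F :=
  if unlift ord0 i is Some j then (if unlift ord0 j is Some j' then l j' else l0) else
    l0.
have l'a i : ample (l' i).
  by rewrite /l'; case: (unlift ord0 i) => // j; case: (unlift ord0 j).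
have l'E : \prod_i l' i = l0 * (l0 * \prod_i l i).
  rewrite !big_ord_recl /l' unlift_none liftK unlift_none; congr (_ * (_ * _)).
  by apply: eq_bigr => i _; rewrite !liftK.
apply: (gram_unit PD dE') => // [|a ak].
  have ln : chow_deg n (\prod_i l i) by apply: chow_deg_prod => i; case: (la i).
  have := chow_degM (chow_degM (chow_degZ c ln) l01) l01; congr chow_deg; lia.
rewrite (_ : _ * l0 * l0 * a = c *: (\prod_i l' i * a)); last first.
  by rewrite l'E -!chow_scalerAl [_ * l0 * l0]mulrC [_ * l0]mulrC.
move/eqP; rewrite scaler_eq0 (negPf c0) => /eqP; exact: (HLinj dE' l'a ak).
Qed.

(** The classes (1 - t) l_i + t l_0 join the given product at t = 0 to l_0^n at t = 1, where the
    unmixed relations hold; definiteness on the primitive part is carried from 1 to 0 by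
    [posdef_compl_path]. *)
Lemma mixed_HR_deg k n (l0 : chow F) (l : 'I_n -> chow F) :
  d = (n + k.*2)%N -> ample l0 -> (forall i, ample (l i)) ->
  hr_positive deg k (l0 * \prod_i l i) (\prod_i l i).
Proof.
move=> dE l0a la a ak La0 a0; have l01 : chow_deg 1 l0 by case: l0a.
have kd : (k.*2 <= d)%N by rewrite dE leq_addl.
have [m [b [bk bs bf]]] := chow_basis UF k.
have [m' [u [uk uP uU]]] := primitive_complement dE l0a.
have /choice[h hE] j : exists v : 'rV[R]_m, l0 * u j = \sum_i v 0 i *: b i by exact: bs.
(* The rows are the coordinates of the l_0 u_j, so the condition v Q H^T = 0 says that v is
   orthogonal to them, that is, primitive. *)
pose H : 'M[R]_(m', m) := \matrix_(j, i) h j 0 i.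
pose lt t i := (1 - t) *: l i + t *: l0.
(* The Hodge-Riemann sign is absorbed here, so that the form sought is positive definite. *)
pose L t := (-1) ^+ k *: \prod_i lt t i.
have lta t i : 0 <= t <= 1 -> ample (lt t i).
  move=> /andP[t0 t1]; apply: ample_comb => //; first by rewrite subr_ge0.
  by rewrite subrK.
have lt1 t i : chow_deg 1 (lt t i).
  by apply: chow_degD; apply: chow_degZ => //; case: (la i).
have Ln t : chow_deg n (L t) by apply: chow_degZ; apply: chow_deg_prod.
have s0 : (-1) ^+ k != 0 :> R by rewrite signr_eq0.
have [Q QE] : exists Q : 'M[{poly R}]_m,
    forall t, map_mx (horner_eval t) Q = gram deg (L t) b.
  have /choice[q qE] i : exists q : 'I_m -> {poly R}, forall j t,
    deg (L t * b i * b j) = (q j).[t].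
    have /choice[q qE] j : exists p : {poly R}, forall t, deg (L t * b i * b j) = p.[t].
      have [p pE] := segment_prod_poly deg l0 l (b i * b j).
      exists ((-1) ^+ k *: p) => t.
      by rewrite hornerZ -pE -mulrA /L -chow_scalerAl linearZ.
    by exists q.
  by exists (\matrix_(i, j) q i j) => t; apply/matrixP => i j;
    rewrite !mxE [LHS]/horner_eval -qE.
have HQ t (v : 'rV_m) j :
    (v *m gram deg (L t) b *m H^T) 0 j = deg (L t * (\sum_i v 0 i *: b i) * (l0 * u j)).
  rewrite hE -gram_form /mxform !mxE; apply: eq_bigr => i _; congr (_ * _).
  by rewrite !mxE.
have HQH t : H *m gram deg (L t) b *m H^T = gram deg (L t * l0 * l0) u.
  apply/matrixP => j j'.
  have -> : (H *m gram deg (L t) b *m H^T) j j' = (row j H *m gram deg (L t) b *m H^T)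
    0 j'.
    by rewrite -!row_mul [RHS]mxE.
  rewrite HQ mxE (_ : \sum_i _ = l0 * u j); last first.
    by rewrite hE; apply: eq_bigr => i _; rewrite !mxE.
  by rewrite !mulrA [L t * l0 * u j * l0]mulrAC.
have path := @posdef_compl_path R m m' Q H; cbv zeta beta in path.
have [v vE] := bs a ak.
have v0 : v != 0.
  by apply: contra_neq a0 => v0; rewrite vE v0 big1 // => i _; rewrite mxE scale0r.
have lt0 : \prod_i lt 0 i = \prod_i l i.
  by apply: eq_bigr => i _; rewrite /lt subr0 scale1r scale0r addr0.
have lt1E : \prod_i lt 1 i = l0 ^+ n.
  rewrite -[in RHS](card_ord n) -prodr_const; apply: eq_bigr => i _.
  by rewrite /lt subrr scale0r add0r scale1r.
have := path _ _ v v0; rewrite !QE gram_form -vE /L lt0 -!chow_scalerAl linearZ; apply.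
- move=> t t01; have QEt := QE t; rewrite [map_mx (horner_eval t) Q]QEt; split;
  first exact: gram_sym.
    apply: (gram_unit PD dE) => // x xk; rewrite /L -chow_scalerAl => /eqP.
    rewrite scaler_eq0 (negPf s0) => /eqP; apply: (HLinj dE) => // i; exact: lta.
  by rewrite HQH; apply: uU => // i; exact: lta.
- move=> x x0 xH; rewrite gram_form.
  set y := \sum_i _; have yk : chow_deg k y by apply: chow_deg_sum => i _;
    exact: chow_degZ.
  have Ly : l0 * L 1 * y = 0.
    by apply: uP => // j; rewrite -HQ xH mxE.
  have nE : (d - k.*2 = n)%N by rewrite dE addnK.
  rewrite /L lt1E -!chow_scalerAl linearZ /=; have := HR kd l0a yk; rewrite nE; apply.
    move/eqP: Ly; rewrite /L lt1E -chow_scalerAr -chow_scalerAl scaler_eq0 (negPf s0).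
    by rewrite exprS => /eqP.
  by apply: contra_neq x0; exact: bf.
- rewrite -lt0; apply/rowP => j; rewrite HQ -vE [RHS]mxE /L lt0.
  rewrite mulrCA mulrA mulrA -chow_scalerAr -!chow_scalerAl La0.
  by rewrite mul0r scaler0 linear0.
Qed.

End MixedHR.

(** The relations are proved for the degree map of the Lefschetz structure; any other degree map is
    a positive multiple of it on A^d, since both are positive on the monomial of a top cone. *)
Lemma mixed_HR_of_star (R : realType) (F : fan_data R) d : lefschetz F d ->
  (forall i, [set i]%SET \in cones F -> mixed_HR (star (F := F) [set i]%SET) d.-1) ->
  mixed_HR F d.
Proof.
move=> lF starHR w deg fw dm k kd l0 l l0a la a ak La0 a0.
have UF := lefschetz_coords lF; case: (lF) => w' deg' _ dimF fw' dm' PD HL HR _.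
have dE : d = (d - k.*2 + k.*2)%N by rewrite subnK.
have := mixed_HR_deg lF (mixed_HL_inj lF starHR) PD HR dE l0a la ak La0 a0.
have [t tF td] := top_cone_exists UF dimF.
have p := degree_top_cone UF fw dm tF td; have p' := degree_top_cone UF fw' dm' tF td.
have xd : chow_deg d (\prod_i l i * a * a).
  have Ln : chow_deg (d - k.*2) (\prod_i l i) by apply: chow_deg_prod => i;
    case: (la i).
  by have := chow_degM (chow_degM Ln ak) ak; rewrite -addnA addnn subnK.
have td' : chow_deg d (\prod_(i in t) chow_ray UF i).
  by rewrite -[X in chow_deg X]td; exact: chow_prod_cone_deg.
rewrite [in X in _ -> X](chow_top_line UF PD td' xd (lt0r_neq0 p')) linearZ /= mulrA.
by move=> h; apply: mulr_gt0 => //; rewrite mulrA divr_gt0.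
Qed.

Theorem theorem5p19 (R : realType) (F : fan_data R) (d : nat) :
  lefschetz F d -> mixed_HL F d /\ mixed_HR F d.
Proof.
elim: d F => [|d IH] F lF.
  (* A fan of dimension 0 has no rays, so the hypothesis on stars is vacuous. *)
  have starHR i : [set i]%SET \in cones F -> mixed_HR (star (F := F) [set i]%SET) 0.-1.
    by move=> /(lefschetz_ray lF)[].
  by split; [exact: mixed_HL_of_star | exact: mixed_HR_of_star].
have starHR i : [set i]%SET \in cones F -> mixed_HR (star (F := F) [set i]%SET) d.+1.-1.
  by move=> /(lefschetz_ray lF)[_ /IH[]].
by split; [exact: mixed_HL_of_star | exact: mixed_HR_of_star].
Qed.
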